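(* Let $W=TT^*$ on $\mathbb{R}$ with $T'=GT$, $G$ a matrix polynomial, and let $X^n=Y^nV$ be as in the context. Suppose there exists a non-trivial (non-constant) entire matrix-valued function $S:\mathbb{C}\to\mathbb{C}^{N\times N}$, non-singular on $\mathbb{C}$ and unitary on $\mathbb{R}$, such that $$H(z)=T(z)S'(z)S^*(z)T^{-1}(z)$$ is also a matrix polynomial. Then $\widetilde T=TS$ satisfies $$W(x)=\widetilde T(x)\widetilde T^*(x),\quad x\in\mathbb{R},\qquad \widetilde T'(z)=\widetilde G(z)\widetilde T(z),\quad z\in\mathbb{C},$$ with $\widetilde G(z)=G(z)+H(z)$. Moreover, for every $n\ge0$, $X^n$ satisfies, along with $\frac{d}{dz}X^n(z)=F_n(z;G)X^n(z)$, the relation $$\frac{d}{dz}X^n(z)=\big(F_n(z;G)+F_n(z;H)\big)X^n(z)-X^n(z)\begin{pmatrix}\chi(z)&0\\0&-\chi^*(z)\end{pmatrix},\qquad z\in\mathbb{C}\setminus\mathbb{R},$$ where $\chi(z)=S'(z)S^*(z)$.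
   Context: Fix $N\ge1$. The weight $W:\mathbb{R}\to GL(N,\mathbb{R})$ is smooth, $W(x)$ is (symmetric) positive definite for every $x\in\mathbb{R}$, and all entries of $W$ and $W'$ have finite moments of all orders on $\mathbb{R}$. $A^*$ is the conjugate transpose, $A^{-*}=(A^* )^{-1}$; for matrix functions of a complex variable $F^*(z):=(F(\bar z))^*$. It is assumed that $W(x)=T(x)T^*(x)$ for $x\in\mathbb{R}$, where $T$ is a smooth $N\times N$ matrix-valued function satisfying $T'=GT$ with a matrix polynomial $G$; hence $T$ extends to an entire, everywhere invertible matrix function satisfying $T'(z)=G(z)T(z)$ on $\mathbb{C}$. $\widehat P_n(x)=x^nI_N+\sum_{j=0}^{n-1}a_{n,j}x^j$ is the monic matrix polynomial of degree $n$ with $\int_{\mathbb{R}}\widehat P_n W Q^*dx=0$ for all matrix polynomials $Q$ of degree $\le n-1$; $a_{n,n}=I_N$ and $a_{n,j}=0$ for $j<0$ or $j>n$. $\gamma_n=\big(\int_{\mathbb{R}}\widehat P_nW\widehat P_n^*dx\big)^{-1}$. $b_{n,k}=\int_{\mathbb{R}}x^k\widehat P_n(x)W(x)dx$ for $k\ge n$, and $b_{n,k}=0$ for $k<n$. $\mathcal{C}(F)(z)=\frac1{2\pi i}\int_{\mathbb{R}}\frac{F(t)}{t-z}dt$. In $N\times N$ blocks, $Y^0(z)=\begin{pmatrix}I_N&\mathcal{C}(W)(z)\\0&I_N\end{pmatrix}$ and for $n\ge1$ $$Y^n(z)=\begin{pmatrix}\widehat P_n(z)&\mathcal{C}(\widehat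 P_nW)(z)\\ -2\pi i\gamma_{n-1}\widehat P_{n-1}(z)&-2\pi i\gamma_{n-1}\mathcal{C}(\widehat P_{n-1}W)(z)\end{pmatrix},\quad z\in\mathbb{C}\setminus\mathbb{R};$$ $V(z)=\begin{pmatrix}T(z)&0\\0&T^{-*}(z)\end{pmatrix}$, $X^n(z)=Y^n(z)V(z)$. For any matrix polynomial $K(z)=\sum_{j=0}^mM_jz^j$ define $\widehat P_{n,k}(z)=z^kI_N+a_{n,n-1}z^{k-1}+\cdots+a_{n,n-k}$, $\Delta_{j,n}(z)=\sum_{k=0}^j\widehat P_{n,k}(z)M_{m-j+k}$, $$\mathcal{A}_n(z;K)=-\gamma_n\sum_{j=0}^{m-1}\big(b_{n,n+m-j-1}\Delta_{j,n}^*(z)+\Delta_{j,n}(z)b_{n,n+m-j-1}^*\big),$$ $$\mathcal{B}_n(z;K)=-\sum_{j=0}^{m}\big(\Delta_{j,n}(z)b_{n-1,n+m-j-1}^*+b_{n,n+m-j-2}\Delta_{j,n-1}^*(z)\big)\gamma_{n-1}\quad(n\ge1),$$ $$F_n(z;K)=\begin{pmatrix}-\mathcal{B}_n(z;K)&-\frac1{2\pi i}\gamma_n^{-1}\mathcal{A}_n(z;K)\\ 2\pi i\,\mathcal{A}_{n-1}(z;K)\gamma_{n-1}&\mathcal{B}_n^*(z;K)\end{pmatrix},$$ with the conventions $\mathcal{B}_0(z;K):=-K(z)$ and $\mathcal{A}_{-1}(z;K)\gamma_{-1}:=0$ for $n=0$. *)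

(* Defs.v *)
From HB Require Import structures.
From mathcomp Require Import all_boot all_order all_algebra.
From mathcomp Require Import all_classical all_reals all_analysis.
From mathcomp Require Import complex.

Set Implicit Arguments.
Unset Strict Implicit.
Unset Printing Implicit Defensive.

Import Order.TTheory GRing.Theory Num.Theory.
Import numFieldNormedType.Exports.

Local Open Scope classical_set_scope.
Local Open Scope ring_scope.
Local Open Scope sesquilinear_scope.
Local Open Scope complex_scope.

(* The topology of the complex numbers R[i] is carried by the alias R[i]^o,
   hence the casts below; derivatives of matrix functions are entrywise. *)
Definition is_cderive (R : realType) (p q : nat)
    (F : R[i] -> 'M[R[i]]_(p, q)) (z : R[i]) (L : 'M[R[i]]_(p, q)) : Prop :=
  forall i j,
    is_derive (z : R[i]^o) (1 : R[i]^o)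
      ((fun w => F w i j) : R[i]^o -> R[i]^o) (L i j).

Definition entire (R : realType) (p q : nat)
    (F : R[i] -> 'M[R[i]]_(p, q)) : Prop :=
  forall z i j,
    derivable ((fun w => F w i j) : R[i]^o -> R[i]^o) (z : R[i]^o) (1 : R[i]^o).

Definition cderiv (R : realType) (p q : nat)
    (F : R[i] -> 'M[R[i]]_(p, q)) (z : R[i]) : 'M[R[i]]_(p, q) :=
  \matrix_(i, j)
    ('D_(1 : R[i]^o) ((fun w => F w i j) : R[i]^o -> R[i]^o) (z : R[i]^o)).

(* F^*(z) = (F(conj z))^*; at real points this is the pointwise adjoint. *)
Definition adjf (R : realType) (p q : nat)
    (F : R[i] -> 'M[R[i]]_(p, q)) (z : R[i]) : 'M[R[i]]_(q, p) :=
  (F z^*)^t*.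

Definition cintegral (R : realType) (f : R -> R[i]) : R[i] :=
  (\int[lebesgue_measure]_x complex.Re (f x)) +i*
  (\int[lebesgue_measure]_x complex.Im (f x)).

Definition mxintegral (R : realType) (p q : nat)
    (F : R -> 'M[R[i]]_(p, q)) : 'M[R[i]]_(p, q) :=
  \matrix_(i, j) cintegral (fun x => F x i j).

Definition two_pi_i (R : realType) : R[i] := 2 * (pi : R)%:C * 'i.

Definition cauchy (R : realType) (p q : nat)
    (F : R -> 'M[R[i]]_(p, q)) (z : R[i]) : 'M[R[i]]_(p, q) :=
  (two_pi_i R)^-1 *: mxintegral (fun t => (t%:C - z)^-1 *: F t).

Definition mpeval (R : realType) (N : nat)
    (K : {poly 'M[R[i]]_N.+1}) (z : R[i]) : 'M[R[i]]_N.+1 :=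
  K.[z%:M].

Definition smooth_weight (R : realType) (N : nat)
    (W : R -> 'M[R]_N.+1) : Prop :=
  forall (i j : 'I_N.+1) (k : nat) (x : R),
    derivable (derive1n k (fun y => W y i j)) x 1.

Definition posdef_weight (R : realType) (N : nat)
    (W : R -> 'M[R]_N.+1) : Prop :=
  forall x, (W x)^T = W x /\
    forall v : 'rV[R]_N.+1, v != 0 -> 0 < (v *m W x *m v^T) 0 0.

Definition finite_moments (R : realType) (f : R -> R) : Prop :=
  forall k : nat,
    lebesgue_measure.-integrable setT (EFin \o (fun x : R => x ^+ k * f x)).

Definition weight (R : realType) (N : nat) (W : R -> 'M[R]_N.+1) : Prop :=
  [/\ smooth_weight W, posdef_weight W &
      forall i j, finite_moments (fun x => W x i j) /\
                  finite_moments (derive1 (fun x => W x i j))].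

Section RiemannHilbert.
Context (R : realType) (N : nat).
Context (W : R -> 'M[R]_N.+1).
Context (P : nat -> {poly 'M[R[i]]_N.+1}).

Definition Wc (x : R) : 'M[R[i]]_N.+1 := map_mx (real_complex R) (W x).

Definition mxinner (A B : {poly 'M[R[i]]_N.+1}) : 'M[R[i]]_N.+1 :=
  mxintegral (fun x => mpeval A x%:C *m Wc x *m (mpeval B x%:C)^t*).

Definition monic_orthogonal : Prop :=
  forall n : nat,
    [/\ P n \is monic, size (P n) = n.+1 &
        forall Q : {poly 'M[R[i]]_N.+1}, (size Q <= n)%N ->
          mxinner (P n) Q = 0].

Definition gam (n : nat) : 'M[R[i]]_N.+1 := invmx (mxinner (P n) (P n)).

Definition bcoef (n k : nat) : 'M[R[i]]_N.+1 :=
  if (n <= k)%N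
  then mxintegral (fun x => x%:C ^+ k *: (mpeval (P n) x%:C *m Wc x))
  else 0.

Definition PW (n : nat) (x : R) : 'M[R[i]]_N.+1 := mpeval (P n) x%:C *m Wc x.

Definition Y (n : nat) (z : R[i]) : 'M[R[i]]_(N.+1 + N.+1) :=
  if n is p.+1 then
    block_mx (mpeval (P n) z)
             (cauchy (PW n) z)
             (- two_pi_i R *: (gam p *m mpeval (P p) z))
             (- two_pi_i R *: (gam p *m cauchy (PW p) z))
  else block_mx 1%:M (cauchy Wc z) 0 1%:M.

Definition V (T : R[i] -> 'M[R[i]]_N.+1) (z : R[i]) :
    'M[R[i]]_(N.+1 + N.+1) :=
  block_mx (T z) 0 0 (invmx (adjf T z)).

Definition X (T : R[i] -> 'M[R[i]]_N.+1) (n : nat) (z : R[i]) :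
    'M[R[i]]_(N.+1 + N.+1) :=
  Y n z *m V T z.

(* \hat P_{n,k}(z) = sum_(l <= k) a_{n,n-l} z^(k-l), where a_{n,j} = 0 for
   j < 0; the filter is needed because n - l is truncated. *)
Definition Pk (n k : nat) (z : R[i]) : 'M[R[i]]_N.+1 :=
  \sum_(l < k.+1 | (l <= n)%N) z ^+ (k - l) *: (P n)`_(n - l).

(* m is the degree of K (0 for K = 0). *)
Definition Delta (K : {poly 'M[R[i]]_N.+1}) (j n : nat) (z : R[i]) :
    'M[R[i]]_N.+1 :=
  let m := (size K).-1 in
  \sum_(k < j.+1) Pk n k z *m K`_(m - j + k).

Definition calA (K : {poly 'M[R[i]]_N.+1}) (n : nat) (z : R[i]) :
    'M[R[i]]_N.+1 :=
  let m := (size K).-1 in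
  - gam n *m
    \sum_(j < m) (bcoef n (n + m - j - 1) *m adjf (Delta K j n) z
                  + Delta K j n z *m (bcoef n (n + m - j - 1))^t*).

(* The index n + m - j - 2 equals -1 when n = 1 and j = m; it is truncated
   to 0, which is harmless since bcoef 1 0 = 0. *)
Definition calB (K : {poly 'M[R[i]]_N.+1}) (n : nat) (z : R[i]) :
    'M[R[i]]_N.+1 :=
  let m := (size K).-1 in
  if n is p.+1 then
    - (\sum_(j < m.+1)
         (Delta K j n z *m (bcoef p (n + m - j - 1))^t*
          + bcoef n (n + m - j - 2) *m adjf (Delta K j p) z)) *m gam p
  else - mpeval K z.

Definition Fmx (K : {poly 'M[R[i]]_N.+1}) (n : nat) (z : R[i]) :
    'M[R[i]]_(N.+1 + N.+1) :=
  block_mx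
    (- calB K n z)
    (- (two_pi_i R)^-1 *: (invmx (gam n) *m calA K n z))
    (if n is p.+1 then two_pi_i R *: (calA K p z *m gam p) else 0)
    (adjf (calB K n) z).

End RiemannHilbert.

(* Main.v *)
(* Write [F#] for the adjoint function [z |-> F(conj z)^*]. Let [eps W' = K W + W K#] on the
   real line for a matrix polynomial [K]. Then, off the real line,
     [eps Y' = F_n(K) Y - Y diag(K, - K#)].
   With [eps = 1], [K = G] and [(T#)^-1' = - G# (T#)^-1] this is the first equation for [X^n].
   With [eps = 0], [K = H] it says [F_n(H) Y = Y diag(H, - H#)], which is the difference of the
   two equations, since [H T = T chi].

   For polynomials [A], [B] let [E(A, B)(z)] be the integral over [t] of
     [((A K)(z) - (A K)(t)) / (z - t) W B# + A W ((B K)#(z) - (B K)#(t)) / (z - t)].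
   Then [A_n = - gamma_n E(P_n, P_n)] and [B_n = - E(P_n, P_{n-1}) gamma_{n-1}]. Integration by
   parts and orthogonality show that, for [A], [B] among [P_n] and [P_{n-1}], with the Cauchy
   transform [c(A) = int A W / (t - z)],
     [E(A, B) = (eps c(A)' - c(A) K#) B# - (eps A' + A K) c(B)#].
   The matrix with rows [(P_n, c(P_n))] and [(P_{n-1}, c(P_{n-1}))] has an explicit inverse
   (again by orthogonality), and the entries of the equation for [Y] are the combinations of
   these formulas that this inverse dictates.

   That [S S# = 1] extends from the line to the plane needs no analyticity theory: the entries
   of [H T T# + T T# H#] vanish on the line, and [T T#] solves a linear differential equation
   with polynomial coefficients, for which [poly_ode_identity] gives unique continuation. *)

Require Import Defs.
From HB Require Import structures.
From mathcomp Require Import all_boot all_order all_algebra.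
From mathcomp Require Import all_classical all_reals all_analysis.
From mathcomp Require Import complex.
From mathcomp Require Import measurable_realfun perm zify ring lra.

Set Implicit Arguments.
Unset Strict Implicit.
Unset Printing Implicit Defensive.

Import Order.TTheory GRing.Theory Num.Theory.
Import numFieldNormedType.Exports.

Local Open Scope classical_set_scope.
Local Open Scope ring_scope.
Local Open Scope sesquilinear_scope.
Local Open Scope complex_scope.

(** * Complex derivatives *)

(** The epsilon-delta form over any numeric field; it lets derivatives over [R] and over [R[i]] be
    compared through norm inequalities. *)
Lemma is_deriveP (K : numFieldType) (f : K^o -> K^o) (z l : K) :
  is_derive (z : K^o) (1 : K^o) f l <->
  forall e : K, 0 < e -> exists2 d : K, 0 < d &
    forall h, h != 0 -> `|h| < d -> `|h^-1 * (f (h + z) - f z) - l| < e.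
Proof.
have key : (h^-1 *: ((f \o shift (z : K^o)) (h *: (1 : K^o)) - f z) @[h --> 0^'] --> (l : K^o)) <->
  forall e : K, 0 < e -> exists2 d : K, 0 < d &
    forall h, h != 0 -> `|h| < d -> `|h^-1 * (f (h + z) - f z) - l| < e.
  split.
    move=> /cvgrPdist_lt fl e e0; have := fl e e0.
    move=> /nbhs_ballP [d /= d0 H]; exists d => // h h0 hd.
    have := H h; rewrite /ball /= sub0r normrN => /(_ hd h0).
    by rewrite distrC /= -[h *: 1]/(h * 1) mulr1.
  move=> fl; apply/cvgrPdist_lt => e e0; have [d d0 H] := fl e e0.
  apply/nbhs_ballP; exists d => //= h; rewrite /ball /= sub0r normrN => hd h0.
  by rewrite distrC -[h *: 1]/(h * 1) mulr1; exact: H.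
split=> [fl|/key fl].
  apply/key; have [_ <-] := fl.
  have [/= f1 _] := fl; exact: f1.
apply: DeriveDef; last by apply: cvg_lim.
by apply/cvg_ex; exists l.
Qed.

Section ComplexDerivative.
Context (R : realType).
Local Notation C := R[i].

Definition cder (f : C -> C) (z l : C) : Prop :=
  is_derive (z : C^o) (1 : C^o) (f : C^o -> C^o) l.

Lemma cder_ext (f g : C -> C) z l m :
  f =1 g -> l = m -> cder f z l -> cder g z m.
Proof. by move=> /funext -> ->. Qed.

Lemma cderD f g z l m : cder f z l -> cder g z m ->
  cder (fun w => f w + g w) z (l + m).
Proof. by move=> fl gm; exact: is_deriveD. Qed.

Lemma cderM f g z l m : cder f z l -> cder g z m ->
  cder (fun w => f w * g w) z (l * g z + f z * m).
Proof.
move=> fl gm; rewrite addrC [l * _]mulrC.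
exact: (@is_deriveM _ _ (f : C^o -> C^o) (g : C^o -> C^o)).
Qed.

Lemma cder_cst c z : cder (fun=> c) z 0.
Proof. exact: is_derive_cst. Qed.

Lemma cder_id z : cder id z 1.
Proof. exact: is_derive_id. Qed.

Lemma cder_sum (I : Type) (r : seq I) (P : pred I) (f : I -> C -> C) z (l : I -> C) :
  (forall i, cder (f i) z (l i)) ->
  cder (fun w => \sum_(i <- r | P i) f i w) z (\sum_(i <- r | P i) l i).
Proof.
move=> fl; elim: r => [|i r IH].
  by apply: (cder_ext _ _ (cder_cst 0 z)) => [w|]; rewrite big_nil.
apply: (cder_ext (f := fun w => (if P i then f i w else 0) + \sum_(i <- r | P i) f i w)
  (l := (if P i then l i else 0) + \sum_(i <- r | P i) l i)).
- by move=> w; rewrite big_cons; case: (P i); rewrite ?add0r.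
- by rewrite big_cons; case: (P i); rewrite ?add0r.
- by apply: cderD => //; case: (P i) => //; exact: cder_cst.
Qed.

Lemma cder_prod (I : Type) (r : seq I) (f : I -> C -> C) z :
  (forall i, exists l, cder (f i) z l) ->
  exists l, cder (fun w => \prod_(i <- r) f i w) z l.
Proof.
move=> fl; elim: r => [|i r [m IH]].
  by exists 0; apply: (cder_ext _ _ (cder_cst 1 z)) => [w|]; rewrite ?big_nil.
have [l il] := fl i; eexists.
by apply: (cder_ext _ _ (cderM il IH)) => // w; rewrite big_cons.
Qed.

Lemma cder_unique f z l m : cder f z l -> cder f z m -> l = m.
Proof. by move=> fl fm; have [_ <-] := fl; have [_ <-] := fm. Qed.

Lemma cder_cont f z l : cder f z l -> {for z, continuous (f : C^o -> C^o)}.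
Proof.
by move=> fl; apply: differentiable_continuous; apply/derivable1_diffP; have [] := fl.
Qed.

Lemma cder_inv f z l : f z != 0 -> cder f z l ->
  cder (fun w => (f w)^-1) z (- (f z) ^- 2 * l).
Proof.
move=> fz fl; have [df dl] := fl; apply: DeriveDef; first exact: derivableV.
rewrite (@deriveV _ _ (f : C^o -> C^o) _ _ fz df) dl //.
Qed.

(** The difference quotient of the doubly conjugated function with step [h] is the conjugate of the
    quotient of [f] with step [h^*], and conjugation preserves norms. *)
Lemma cder_conj f z l : cder f z^* l -> cder (fun w => (f w^*)^*) z l^*.
Proof.
move=> /is_deriveP fl; apply/is_deriveP => e e0; have [d d0 H] := fl e e0.
exists d => // h h0 hd.
have := H h^* ; rewrite conjc_eq0 normcJ => /(_ h0 hd) {}H.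
rewrite -normcJ; apply: le_lt_trans H.
rewrite le_eqVlt; apply/orP; left; apply/eqP; congr (`| _ |).
by rewrite !rmorphB !rmorphM !rmorphB /= !conjcK rmorphD /= conjc_inv.
Qed.

(** An error linear in the step tends to 0; the resolvent estimate for Cauchy transforms comes in
    this form. *)
Lemma cder_lip f z l (M d : C) : 0 < d ->
  (forall h, h != 0 -> `|h| < d -> `|h^-1 * (f (h + z) - f z) - l| <= M * `|h|) ->
  cder f z l.
Proof.
move=> d0 H; apply/is_deriveP => e e0.
(* The shift by 1 keeps the divisor in [e / M1] positive even when [M] is 0. *)
pose M1 := `|M| + 1.
have M10 : 0 < M1 by rewrite ltr_wpDl.
have dr : d / 2 > 0 by rewrite divr_gt0.
exists (Num.min d (e / M1)).
  by rewrite /Num.min; case: ifP => _ //; rewrite divr_gt0.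
(* The order of [C] is partial, so a bound by the minimum needs comparability, which positive
   elements have. *)
have cmp : d >=< e / M1 by rewrite real_comparable ?gtr0_real ?divr_gt0.
move=> h h0; rewrite comparable_lt_min // => /andP[hd hM].
apply: le_lt_trans (H h h0 hd) _.
have hn : 0 < `|h| by rewrite normr_gt0.
have M0 : 0 <= M by rewrite -(pmulr_lge0 _ hn); exact: le_trans (normr_ge0 _) (H h h0 hd).
apply: (@le_lt_trans _ _ (M1 * `|h|)).
  by rewrite ler_wpM2r // /M1 ger0_norm // lerDl.
by rewrite mulrC -ltr_pdivlMr.
Qed.

End ComplexDerivative.

(** * Calculus of matrix-valued functions *)

Section MatrixDerivative.
Context (R : realType).
Local Notation C := R[i].

Lemma is_cderive_ext p q (F G : C -> 'M[C]_(p, q)) z L M :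
  F =1 G -> L = M -> is_cderive F z L -> is_cderive G z M.
Proof. by move=> /funext -> ->. Qed.

Lemma is_cderive_unique p q (F : C -> 'M[C]_(p, q)) z L M :
  is_cderive F z L -> is_cderive F z M -> L = M.
Proof. by move=> FL FM; apply/matrixP => i j; exact: cder_unique (FL i j) (FM i j). Qed.

Lemma is_cderive_cst p q (A : 'M[C]_(p, q)) z : is_cderive (fun=> A) z 0.
Proof. by move=> i j; rewrite mxE; exact: cder_cst. Qed.

Lemma is_cderiveD p q (F G : C -> 'M[C]_(p, q)) z L M :
  is_cderive F z L -> is_cderive G z M -> is_cderive (fun w => F w + G w) z (L + M).
Proof.
move=> FL GM i j; apply: cder_ext (cderD (FL i j) (GM i j)) => [w|];
by rewrite mxE.
Qed.

Lemma is_cderiveM p q r (F : C -> 'M[C]_(p, q)) (G : C -> 'M[C]_(q, r)) z L M :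
  is_cderive F z L -> is_cderive G z M ->
  is_cderive (fun w => F w *m G w) z (L *m G z + F z *m M).
Proof.
move=> FL GM i j.
have := @cder_sum R _ (index_enum 'I_q) xpredT (fun k w => F w i k * G w k j) z _
  (fun k => cderM (FL i k) (GM k j)).
apply: cder_ext => [w|]; first by rewrite mxE.
by rewrite !mxE -big_split.
Qed.

Lemma is_cderiveZ p q (f : C -> C) (F : C -> 'M[C]_(p, q)) z l L :
  cder f z l -> is_cderive F z L ->
  is_cderive (fun w => f w *: F w) z (l *: F z + f z *: L).
Proof.
by move=> fl FL i j; apply: cder_ext (cderM fl (FL i j)) => [w|]; rewrite !mxE.
Qed.

Lemma is_cderive_block p q r s (A : C -> 'M[C]_(p, q)) (B : C -> 'M[C]_(p, s))
    (D : C -> 'M[C]_(r, q)) (E : C -> 'M[C]_(r, s)) z A' B' D' E' :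
  is_cderive A z A' -> is_cderive B z B' ->
  is_cderive D z D' -> is_cderive E z E' ->
  is_cderive (fun w => block_mx (A w) (B w) (D w) (E w)) z (block_mx A' B' D' E').
Proof.
move=> hA hB hD hE i j.
case: (split_ordP i) => i' ->; case: (split_ordP j) => j' ->.
- by apply: cder_ext (hA i' j') => [w|]; rewrite block_mxEul.
- by apply: cder_ext (hB i' j') => [w|]; rewrite block_mxEur.
- by apply: cder_ext (hD i' j') => [w|]; rewrite block_mxEdl.
- by apply: cder_ext (hE i' j') => [w|]; rewrite block_mxEdr.
Qed.

Lemma is_cderive_adjf p q (F : C -> 'M[C]_(p, q)) z L :
  is_cderive F z^* L -> is_cderive (adjf F) z (L^t*).
Proof.
move=> FL i j; apply: cder_ext (cder_conj (FL j i)) => [w|]; by rewrite !mxE.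
Qed.

(** By Cramer's formula the entries of the inverse are quotients of determinants, hence
    differentiable. The value of the derivative is then forced by differentiating
    [F *m invmx F = 1]. *)
Lemma is_cderive_inv n (F : C -> 'M[C]_n) z L :
  (forall w, F w \in unitmx) -> is_cderive F z L ->
  is_cderive (fun w => invmx (F w)) z (- (invmx (F z) *m L *m invmx (F z))).
Proof.
move=> uF FL.
have [M FM] : exists M, is_cderive (fun w => invmx (F w)) z M.
  have det_der m (G : C -> 'M[C]_m) : (forall i j, exists l, cder (fun w => G w i j) z l) ->
      exists l, cder (fun w => \det (G w)) z l.
    move=> hG.
    have hp s : exists l, cder (fun w => (-1) ^+ (s : {perm 'I_m}) * \prod_i G w i (s i)) z l.
      have [l hl] := cder_prod (index_enum _) (fun i => hG i (s i)).
      by exists (0 * \prod_i G z i (s i) + (-1) ^+ s * l); exact: cderM (cder_cst _ _) hl.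
    exists (\sum_s projT1 (cid (hp s))).
    by apply: (@cder_sum R _ (index_enum _) xpredT) => s; case: cid.
  have hinv i j : exists l, cder (fun w => invmx (F w) i j) z l.
    have [d hd] := det_der _ F (fun i j => ex_intro _ _ (FL i j)).
    have [c hc] : exists l, cder (fun w => \det (row' j (col' i (F w)))) z l.
      apply: det_der => k l; exists (L (lift j k) (lift i l)).
      by apply: cder_ext (FL (lift j k) (lift i l)) => // w; rewrite !mxE.
    have dn0 : \det (F z) != 0 by have := uF z; rewrite unitmxE unitfE.
    have := cderM (cder_inv dn0 hd) (cderM (cder_cst ((-1) ^+ (j + i)) z) hc).
    move=> H; eexists; apply: cder_ext H => // w.
    by rewrite /invmx uF !mxE.
  exists (\matrix_(i, j) projT1 (cid (hinv i j))) => i j.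
  by rewrite mxE; case: cid.
have : L *m invmx (F z) + F z *m M = 0.
  apply: (is_cderive_unique (F := fun=> 1%:M)); last exact: is_cderive_cst.
  by apply: is_cderive_ext (is_cderiveM FL FM) => // w; rewrite mulmxV.
move/eqP; rewrite addrC addr_eq0 => /eqP FM0.
apply: is_cderive_ext FM => //.
by rewrite -[LHS](mulKmx (uF z)) FM0 mulmxN mulmxA.
Qed.

End MatrixDerivative.

(** * Conjugate transposes *)

Section AdjointMx.
Context (R : realType).
Local Notation C := R[i].

Lemma trmxCM p q r (A : 'M[C]_(p, q)) (B : 'M[C]_(q, r)) :
  (A *m B)^t* = B^t* *m A^t*.
Proof. by rewrite trmx_mul map_mxM. Qed.

Lemma trmxCD p q (A B : 'M[C]_(p, q)) : (A + B)^t* = A^t* + B^t*.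
Proof. by rewrite linearD /= map_mxD. Qed.

Lemma trmxCN p q (A : 'M[C]_(p, q)) : (- A)^t* = - A^t*.
Proof. by rewrite linearN /= map_mxN. Qed.

Lemma trmxCZ p q a (A : 'M[C]_(p, q)) : (a *: A)^t* = conjc a *: A^t*.
Proof. by apply/matrixP => i j; rewrite !mxE rmorphM. Qed.

Lemma trmxC_sum p q (I : Type) (r : seq I) (P : pred I) (F : I -> 'M[C]_(p, q)) :
  (\sum_(i <- r | P i) F i)^t* = \sum_(i <- r | P i) (F i)^t*.
Proof. by elim/big_rec2: _ => [|i A B _ <-]; rewrite ?trmxCD // trmx0 map_mx0. Qed.

Lemma trmxCV n (A : 'M[C]_n) : (invmx A)^t* = invmx (A^t*).
Proof. by rewrite trmx_inv map_invmx. Qed.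

Lemma adjfM p q r (F : C -> 'M[C]_(p, q)) (G : C -> 'M[C]_(q, r)) z :
  adjf (fun w => F w *m G w) z = adjf G z *m adjf F z.
Proof. exact: trmxCM. Qed.

End AdjointMx.

(** * Matrix polynomials and their difference quotients *)

Section MatrixPoly.
Context (R : realType) (N : nat).
Local Notation C := R[i].
Local Notation mpoly := {poly 'M[C]_N.+1}.
Implicit Types (A B K : mpoly) (z w : C).

(** Scalar matrices are central, which makes evaluation at [z%:M] multiplicative although the
    coefficients do not commute. *)
Lemma scalar_comm z K : comm_poly K z%:M.
Proof. by rewrite /comm_poly -!mulmxE mul_mx_scalar mul_scalar_mx. Qed.

Lemma mpevalD A B z : mpeval (A + B) z = mpeval A z + mpeval B z.
Proof. exact: hornerD. Qed.

Lemma mpevalB A B z : mpeval (A - B) z = mpeval A z - mpeval B z.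
Proof. by rewrite /mpeval hornerD hornerN. Qed.

Lemma mpevalC (c : 'M[C]_N.+1) z : mpeval c%:P z = c.
Proof. exact: hornerC. Qed.

Lemma mpevalX z : mpeval ('X : mpoly) z = z%:M.
Proof. exact: hornerX. Qed.

Lemma mpevalM A B z : mpeval (A * B) z = mpeval A z *m mpeval B z.
Proof. by rewrite /mpeval hornerM_comm //; exact: scalar_comm. Qed.

Lemma mpeval0 z : mpeval (0 : mpoly) z = 0.
Proof. exact: horner0. Qed.

Lemma mpevalE n A z : (size A <= n)%N -> mpeval A z = \sum_(i < n) z ^+ i *: A`_i.
Proof.
move=> sA; rewrite /mpeval (horner_coef_wide _ sA); apply: eq_bigr => i _.
by rewrite -scalemx1 exprZn expr1n -scalerAr mulr1.
Qed.

Lemma mpeval_derive K z : is_cderive (mpeval K) z (mpeval K^`() z).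
Proof.
elim/poly_ind: K => [|K c IH].
  apply: is_cderive_ext (is_cderive_cst 0 z) => [w|]; by rewrite ?deriv0 mpeval0.
apply: is_cderive_ext
  (is_cderiveD (is_cderiveZ (cder_id z) IH) (is_cderive_cst c z)) => [w|].
  by rewrite mpevalD mpevalM mpevalX mpevalC mul_mx_scalar.
rewrite derivD derivM derivX derivC mulr1 !addr0 mpevalD mpevalM mpevalX mul_mx_scalar.
by rewrite scale1r addrC.
Qed.

(** The difference quotient [(B(z) - B(w)) / (z - w)] as a polynomial in [z]; its coefficients are
    the partial sums of Horner's scheme for [B] at [w]. *)
Definition dq B w : mpoly := \poly_(k < (size B).-1) mpeval (drop_poly k.+1 B) w.

Lemma size_dq B w : (size (dq B w) <= (size B).-1)%N.
Proof. exact: size_poly. Qed.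

Lemma coef_dq B w k : (dq B w)`_k = mpeval (drop_poly k.+1 B) w.
Proof.
rewrite coef_poly; case: ltnP => // sk.
by rewrite drop_poly_eq0 ?mpeval0 // -ltnS; case: (size B) sk.
Qed.

(** One step of Horner's scheme. *)
Lemma mpeval_drop B w k : mpeval (drop_poly k B) w = B`_k + w *: mpeval (drop_poly k.+1 B) w.
Proof.
have -> : drop_poly k B = drop_poly k.+1 B * 'X + (B`_k)%:P.
  apply/polyP => -[|i]; rewrite coefD coef_drop_poly coefMX coefC /=.
    by rewrite add0r.
  by rewrite coef_drop_poly addr0 addnS.
by rewrite mpevalD mpevalM mpevalX mpevalC mul_mx_scalar addrC.
Qed.

Lemma dqE B w : B = (mpeval B w)%:P + dq B w * ('X - (w%:M)%:P).
Proof.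
apply/polyP => k; rewrite coefD coefC mulrBr coefB coefMC.
rewrite coefMX !coef_dq; case: k => [|k] /=.
  rewrite -[X in mpeval X w]drop_poly0l mpeval_drop -mulmxE mul_mx_scalar.
  by rewrite sub0r addrK.
by rewrite add0r [mpeval (drop_poly k.+1 B) w]mpeval_drop -mulmxE
  mul_mx_scalar addrK.
Qed.

Lemma mpeval_dq B w z : mpeval B z = mpeval B w + (z - w) *: mpeval (dq B w) z.
Proof.
rewrite {1}(dqE B w) mpevalD mpevalC mpevalM mpevalB mpevalX mpevalC -raddfB.
by rewrite mul_mx_scalar.
Qed.

Lemma mpeval_dq_diag B w : mpeval (dq B w) w = mpeval B^`() w.
Proof.
rewrite {2}(dqE B w) derivD derivC add0r derivM derivB derivX derivC subr0 mulr1.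
by rewrite mpevalD mpevalM mpevalB mpevalX mpevalC subrr mulmx0 add0r.
Qed.

End MatrixPoly.

(** * Linear differential equations on segments *)

Section RealPaths.
Context (R : realType).
Local Notation C := R[i].

Lemma normcR (z : C) : `|z| = (complex.Re `|z|)%:C.
Proof. by []. Qed.

Lemma normc_real (x : R) : `|x%:C| = `|x|%:C.
Proof. by rewrite normc_def /= expr0n addr0 sqrtr_sqr. Qed.

Lemma Re_norm_ge0 (z : C) : 0 <= complex.Re `|z|.
Proof. by have := normr_ge0 z; rewrite lecE => /andP[]. Qed.

Lemma normRe (z : C) : `|complex.Re z| <= complex.Re `|z|.
Proof. by rewrite -lecR -normcR normc_ge_Re. Qed.

Lemma norm_i : `|'i : C| = 1.
Proof. by rewrite normc_def /= expr0n expr1n add0r sqrtr1. Qed.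

Lemma normIm (z : C) : `|complex.Im z| <= complex.Re `|z|.
Proof.
by have := normRe (z * 'i); rewrite ReiNIm normrN normrM norm_i mulr1.
Qed.

Lemma ReM (x y : C) :
  complex.Re (x * y) = complex.Re x * complex.Re y - complex.Im x * complex.Im y.
Proof. by case: x y => a b [c d]. Qed.

Lemma ImM (x y : C) :
  complex.Im (x * y) = complex.Re x * complex.Im y + complex.Im x * complex.Re y.
Proof. by case: x y => a b [c d]. Qed.

(** Restriction to a segment, split into real and imaginary parts, makes the real theorems on
    monotonicity and extreme values applicable. *)
Lemma is_derive_path (f : C -> C) (a w l : C) (t : R) :
  cder f (a + t%:C * w) l ->
  is_derive (t : R^o) (1 : R^o) ((fun s => complex.Re (f (a + s%:C * w))) : R^o -> R^o)
    (complex.Re (w * l)) /\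
  is_derive (t : R^o) (1 : R^o) ((fun s => complex.Im (f (a + s%:C * w))) : R^o -> R^o)
    (complex.Im (w * l)).
Proof.
move=> /is_deriveP fl.
(* The constant path is treated apart, since below the increment [h w] of the argument has to be
   inverted. *)
have [->|w0] := eqVneq w 0.
  rewrite mul0r; split; apply/is_deriveP => e e0; exists 1 => // h h0 _;
  by rewrite !mulr0 subrr mulr0 subrr normr0.
have nw0 : 0 < complex.Re `|w| by rewrite -ltcR -normcR normr_gt0.
have key e : 0 < e -> exists2 d : R, 0 < d & forall h, h != 0 -> `|h| < d ->
    `|(h^-1)%:C * (f (a + (h + t)%:C * w) - f (a + t%:C * w)) - w * l| < e%:C.
  move=> e0; have [|d] := fl (e / complex.Re `|w|)%:C; first by rewrite ltcR divr_gt0.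
  case: d => d d' /[dup] d0; rewrite ltcE /= => /andP[/eqP d'0 {}d0] H.
  exists (d / complex.Re `|w|); first by rewrite divr_gt0.
  move=> h h0 hd; have hw0 : h%:C * w != 0.
    by rewrite mulf_neq0 // eq_complex /= eqxx andbT.
  have := H _ hw0; rewrite d'0 normrM normc_real (normcR w).
  rewrite -rmorphM ltcR -ltr_pdivlMr // => /(_ hd) {}H.
  have -> : (h^-1)%:C * (f (a + (h + t)%:C * w) - f (a + t%:C * w)) - w * l =
      w * ((h%:C * w)^-1 * (f (h%:C * w + (a + t%:C * w)) - f (a + t%:C * w)) - l).
    rewrite [RHS]mulrBr mulrA invfM [w * (_ * _)]mulrCA mulfV // mulr1 fmorphV.
    by congr (_ * (f _ - _) - _); rewrite rmorphD /= mulrDl addrCA.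
  rewrite normrM -ltr_pdivlMl ?normr_gt0 //; apply: lt_le_trans H _.
  by rewrite (normcR w) mulrC rmorphM /= fmorphV.
have eRe (k : R) (x y v : C) : k * (complex.Re x - complex.Re y) - complex.Re v =
    complex.Re (k%:C * (x - y) - v) by move: x y v => [? ?] [? ?] [? ?] /=; ring.
have eIm (k : R) (x y v : C) : k * (complex.Im x - complex.Im y) - complex.Im v =
    complex.Im (k%:C * (x - y) - v) by move: x y v => [? ?] [? ?] [? ?] /=; ring.
split; apply/is_deriveP => e /key[d d0 H]; exists d => // h h0 hd;
  rewrite -ltcR; apply: le_lt_trans (H h h0 hd); rewrite normcR lecR.
  by rewrite eRe normRe.
by rewrite eIm normIm.
Qed.

Lemma path_real (t : R) : 0 + t%:C * 1 = t%:C :> C.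
Proof. by rewrite add0r mulr1. Qed.

Lemma is_derive_real (f : C -> C) (l : C) (t : R) : cder f t%:C l ->
  is_derive (t : R^o) (1 : R^o) ((fun s => complex.Re (f s%:C)) : R^o -> R^o) (complex.Re l) /\
  is_derive (t : R^o) (1 : R^o) ((fun s => complex.Im (f s%:C)) : R^o -> R^o) (complex.Im l).
Proof.
rewrite -{1}(path_real t) => /is_derive_path; rewrite mul1r.
under eq_fun do rewrite path_real.
by under [X in _ /\ is_derive _ _ X _]eq_fun do rewrite path_real.
Qed.

(** The function [e(t) exp(- c t)] has nonpositive derivative on the interval, so it does not
    increase from its initial value 0. *)
Lemma gronwall (e e' : R -> R) (c : R) :
  (forall t, is_derive (t : R^o) (1 : R^o) (e : R^o -> R^o) (e' t)) ->
  (forall t, 0 <= t <= 1 -> e' t <= c * e t) ->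
  e 0 = 0 -> e 1 <= 0.
Proof.
move=> de le e0.
pose g t := e t * expR (- c * t).
have dg t : is_derive (t : R^o) (1 : R^o) (g : R^o -> R^o) ((e' t - c * e t) * expR (- c * t)).
  have d1 := is_deriveZ (- c) (is_derive_id (t : R^o) (1 : R^o)).
  have d2 := @is_derive1_comp R expR (fun t => - c * t) t _ _ (is_derive_expR _) d1.
  apply: is_derive_eq (is_deriveM (de t) d2) _.
  by rewrite /GRing.scale /=; ring.
have : g 1 <= g 0.
  apply: (@ler0_derive1_nincr _ g 0 1) => //.
  - move=> x; rewrite in_itv /= => /andP[x0 x1]; rewrite derive1E; have [_ ->] := dg x.
    by rewrite mulr_le0_ge0 ?expR_ge0 // subr_le0 le // !ltW.
  - by apply: derivable_within_continuous => x _; have [] := dg x.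
by rewrite /g e0 mul0r pmulr_lle0 // expR_gt0.
Qed.

(** The squared modulus is continuous along the segment and attains a maximum there. *)
Lemma bounded_path (m : C -> C) (a w : C) :
  (forall t : R, 0 <= t <= 1 -> exists l, cder m (a + t%:C * w) l) ->
  exists B : R, forall t : R, 0 <= t <= 1 -> complex.Re `|m (a + t%:C * w)| <= B.
Proof.
move=> dm; pose f t := complex.Re (m (a + t%:C * w)) ^+ 2 + complex.Im (m (a + t%:C * w)) ^+ 2.
have [||c _ H] := @EVT_max R f 0 1; first exact: ler01.
  apply: derivable_within_continuous => x; rewrite in_itv /= => x01.
  have [l /is_derive_path[d1 d2]] := dm x x01.
  by have [] := is_deriveD (is_deriveX 2 d1) (is_deriveX 2 d2).
(* From [x ^ 2 <= y] follows [x <= y + 1], which gives a bound without a square root. *)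
exists (f c + 1) => t t01; have := H t; rewrite in_itv /= => /(_ t01) ft.
have : complex.Re `|m (a + t%:C * w)| ^+ 2 <= f c.
  by rewrite normc_def /= sqr_sqrtr // addr_ge0 // sqr_ge0.
set x := complex.Re `|_|; set y := f c => xy.
have x1 := sqr_ge0 (x - 1); have x0 := sqr_ge0 x.
by suff : x <= y + 1 by []; nra.
Qed.

(** Gronwall's inequality for the squared Euclidean norm of [u] along the segment. The coefficients
    [m] are constrained on the segment only, because [poly_ode_identity] supplies rational ones. *)
Lemma linear_ode_zero (d : nat) (u u' : 'I_d -> C -> C) (m : 'I_d -> 'I_d -> C -> C) (a w : C) :
  (forall i z, cder (u i) z (u' i z)) ->
  (forall t : R, 0 <= t <= 1 -> forall i,
     u' i (a + t%:C * w) = \sum_j m i j (a + t%:C * w) * u j (a + t%:C * w)) ->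
  (forall t : R, 0 <= t <= 1 -> forall i j, exists l, cder (m i j) (a + t%:C * w) l) ->
  (forall i, u i a = 0) -> forall i, u i (a + w) = 0.
Proof.
move=> du ode dm ua0.
have [B HB] : exists B : R, forall i j (t : R), 0 <= t <= 1 ->
    complex.Re `|m i j (a + t%:C * w)| <= B.
  have H i j := bounded_path (fun t t01 => dm t t01 i j).
  pose b i j := projT1 (cid (H i j)).
  exists (\sum_i \sum_j `|b i j|) => i j t t01.
  have /(_ t t01) h := projT2 (cid (H i j)).
  apply: le_trans h _; rewrite (bigD1 i) //= (bigD1 j) //= -addrA.
  apply: le_trans (ler_norm _) _; rewrite lerDl addr_ge0 // ?sumr_ge0 // => k _.
  by rewrite sumr_ge0.
pose e t := \sum_i (complex.Re (u i (a + t%:C * w)) ^+ 2 + complex.Im (u i (a + t%:C * w)) ^+ 2).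
pose e' t := \sum_i (2 * complex.Re (u i (a + t%:C * w)) * complex.Re (w * u' i (a + t%:C * w)) +
  2 * complex.Im (u i (a + t%:C * w)) * complex.Im (w * u' i (a + t%:C * w))).
have eE t : e t = \sum_i complex.Re `|u i (a + t%:C * w)| ^+ 2.
  by apply: eq_bigr => i _; rewrite normc_def /= sqr_sqrtr // addr_ge0 // sqr_ge0.
have e1 : e 1 <= 0.
  (* By [2 x y <= x ^ 2 + y ^ 2] each pair [(i, j)] contributes at most [|w| B (r_i ^ 2 + r_j ^ 2)];
     the sum over all pairs is [2 |w| B d] times [e]. *)
  apply: (@gronwall e e' (2 * complex.Re `|w| * B * d%:R)).
  - move=> t; rewrite /e' /e.
    have := @is_derive_sum R R^o R^o d (fun i t => complex.Re (u i (a + t%:C * w)) ^+ 2 +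
       complex.Im (u i (a + t%:C * w)) ^+ 2) t 1.
    have -> : (fun t0 => \sum_i (complex.Re (u i (a + t0%:C * w)) ^+ 2 +
        complex.Im (u i (a + t0%:C * w)) ^+ 2)) =
      \sum_i (fun t0 : R => complex.Re (u i (a + t0%:C * w)) ^+ 2 +
        complex.Im (u i (a + t0%:C * w)) ^+ 2) by apply/funext => s; rewrite fct_sumE.
    apply => i; have [d1 d2] := is_derive_path (du i (a + t%:C * w)).
    have := is_deriveD (is_deriveX 2 d1) (is_deriveX 2 d2).
    by rewrite /GRing.scale /= !expr1.
  - move=> t t01; rewrite eE.
    set r := fun i => complex.Re `|u i (a + t%:C * w)|.
    have w0 : 0 <= complex.Re `|w| := Re_norm_ge0 w.
    have B0 (i : 'I_d) : 0 <= B by apply: le_trans (HB i i t t01); exact: Re_norm_ge0.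
    apply: (@le_trans _ _ (\sum_i \sum_j (complex.Re `|w| * B * (r i ^+ 2 + r j ^+ 2)))).
      apply: ler_sum => i _; rewrite (ode t t01).
      have -> : forall x y : C, 2 * complex.Re x * complex.Re y + 2 * complex.Im x * complex.Im y =
         2 * complex.Re (x^* * y) by move=> [x1 x2] [y1 y2] /=; ring.
      apply: (@le_trans _ _ (2 * (complex.Re `|u i (a + t%:C * w)| *
        (complex.Re `|w| * \sum_j (B * r j))))).
        rewrite ler_pM2l //; apply: le_trans (ler_norm _) _; apply: le_trans (normRe _) _.
        rewrite -lecR -normcR !rmorphM /= -!normcR !normrM normcJ.
        rewrite !ler_wpM2l // rmorph_sum /=; apply: le_trans (ler_norm_sum _ _ _) _.
        apply: ler_sum => j _; rewrite normrM rmorphM /= -normcR ler_wpM2r //.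
        by rewrite normcR lecR HB.
      rewrite [X in 2 * X]mulrCA !mulr_sumr; apply: ler_sum => j _.
      rewrite /r; set x := complex.Re `|u i _|; set y := complex.Re `|u j _|.
      rewrite -subr_ge0; set k := complex.Re `|w|.
      have -> : k * B * (x ^+ 2 + y ^+ 2) - 2 * (k * (x * (B * y))) = k * B * (x - y) ^+ 2 by ring.
      by rewrite mulr_ge0 ?sqr_ge0 // mulr_ge0 // (B0 i).
    rewrite le_eqVlt; apply/orP; left; apply/eqP.
    under eq_bigr do rewrite -mulr_sumr big_split /= sumr_const card_ord.
    rewrite -mulr_sumr big_split /= sumr_const card_ord.
    rewrite -mulr_natr -sumrMnl.
    under eq_bigr do rewrite -mulr_natr.
    by rewrite -mulr_suml; ring.
  - by rewrite eE big1 // => i _; rewrite rmorph0 mul0r addr0 ua0 normr0 /= expr0n.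
move=> i; apply/eqP; rewrite -normr_eq0 normcR.
suff -> : complex.Re `|u i (a + w)| = 0 by [].
have := e1; rewrite eE rmorph1 mul1r => le0.
have : \sum_i complex.Re `|u i (a + w)| ^+ 2 == 0.
  by rewrite eq_le le0 sumr_ge0 // => k _; exact: sqr_ge0.
rewrite psumr_eq0 => [/allP /(_ i)|k _]; last exact: sqr_ge0.
by rewrite mem_index_enum implyTb sqrf_eq0 => /(_ isT) /eqP.
Qed.

End RealPaths.

(** * Linear systems in the plane and unique continuation *)

Section LinearODE.
Context (R : realType).
Local Notation C := R[i].

Lemma matrix_ode_zero (N : nat) (G : {poly 'M[C]_N.+1}) (U : C -> 'cV[C]_N.+1) (a b : C) :
  (forall z, is_cderive U z (mpeval G z *m U z)) -> U a = 0 -> U b = 0.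
Proof.
move=> dU Ua.
have := @linear_ode_zero R N.+1 (fun i z => U z i 0) (fun i z => (mpeval G z *m U z) i 0)
  (fun i j z => mpeval G z i j) a (b - a).
rewrite [a + _]addrC subrK => H; apply/matrixP => i j; rewrite ord1 [RHS]mxE; apply: H.
- by move=> k z; exact: dU.
- by move=> t _ k; rewrite mxE.
- by move=> t _ k l; exists (mpeval G^`() (a + t%:C * (b - a)) k l); exact: mpeval_derive.
- by move=> k; rewrite Ua mxE.
Qed.

(** If [v] is in the kernel of [T b], then [T v] solves the same system and vanishes at [b], hence
    also at [a], where [T] is invertible. *)
Lemma ode_unitmx (N : nat) (G : {poly 'M[C]_N.+1}) (T : C -> 'M[C]_N.+1) (a b : C) :
  (forall z, is_cderive T z (mpeval G z *m T z)) -> T a \in unitmx -> T b \in unitmx.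
Proof.
move=> dT Ta; rewrite unitmxE unitfE -det_tr; apply/det0P => -[v v0 vT].
suff : T a *m v^T = 0.
  move=> /(congr1 (mulmx (invmx (T a)))); rewrite mulKmx // mulmx0 => /(congr1 trmx).
  by rewrite trmxK trmx0 => /eqP; rewrite (negbTE v0).
apply: (matrix_ode_zero (G := G) (U := fun z => T z *m v^T) (a := b)); last first.
  by rewrite -[T b]trmxK -trmx_mul vT trmx0.
move=> z; apply: is_cderive_ext (is_cderiveM (dT z) (is_cderive_cst v^T z)) => //.
by rewrite mulmx0 addr0 mulmxA.
Qed.

Lemma notin_itv (s : seq R) (a b : R) : a < b -> exists2 x, a < x < b & x \notin s.
Proof.
elim: s a b => [|c s IH] a b ab.
  by exists ((a + b) / 2); rewrite ?midf_lt.
have [acb|nacb] := boolP (a < c < b).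
  have /andP[ac cb] := acb; have [x /andP[ax xc] xs] := IH a c ac.
  exists x; first by rewrite ax (lt_trans xc cb).
  by rewrite inE negb_or xs (lt_eqF xc).
have [x axb xs] := IH a b ab; exists x => //.
by rewrite inE negb_or xs andbT; apply: contra nacb => /eqP <-.
Qed.

(** The complement of finitely many vertical lines is dense, and [f] is continuous at [z]. *)
Lemma cder_dense (f : C -> C) (s : seq R) (z l : C) : cder f z l ->
  (forall w, complex.Re w \notin s -> f w = 0) -> f z = 0.
Proof.
move=> /cder_cont /cvgrPdist_lt fz fs; apply/eqP; apply: contraT => fz0.
have /fz /nbhs_ballP[d /= d0 Hd] : 0 < `|f z| by rewrite normr_gt0.
have [h /andP[h0 hd] hs] := @notin_itv s (complex.Re z) (complex.Re z + complex.Re d)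
  ltac:(by rewrite ltrDl; move: d0; rewrite ltcE => /andP[]).
have := Hd (z + (h - complex.Re z)%:C).
rewrite /ball /= opprD addrA subrr sub0r normrN normc_real gtr0_norm ?subr_gt0 //.
have dR : d = (complex.Re d)%:C.
  by move: d0; case: (d) => d1 d2; rewrite ltcE /= => /andP[/eqP ->].
rewrite dR ltcR ltrBlDl hd => /(_ isT).
by rewrite (fs (z + _)) ?subr0 ?ltxx // raddfD /= addrC subrK.
Qed.

(** At a real point the complex derivative may be computed along real increments, where the function
    is constantly 0. *)
Lemma cder_zero_on_reals (f : C -> C) (f' : C -> C) :
  (forall z, cder f z (f' z)) -> (forall x : R, f x%:C = 0) -> forall x : R, f' x%:C = 0.
Proof.
move=> df f0 x.
have [] := is_derive_real (df x%:C); under eq_fun do rewrite f0.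
move=> [_ d1]; under eq_fun do rewrite f0; move=> [_ d2].
apply/eqP; rewrite eq_complex -d1 -d2 /=; apply/andP; split; apply/eqP;
exact: derive_cst.
Qed.

Lemma cder_horner (p : {poly C}) z : cder (fun w => p.[w]) z p^`().[z].
Proof.
elim/poly_ind: p => [|p c IH].
  by apply: cder_ext (cder_cst 0 z) => [w|]; rewrite ?deriv0 horner0.
apply: cder_ext (cderD (cderM IH (cder_id z)) (cder_cst c z)) => [w|].
  by rewrite !hornerE.
by rewrite derivD derivM derivX derivC !hornerE.
Qed.

(* Among the first [#|I| + 1] derivatives of [q . om], which all have the form [q_k . om],
   there is a linear relation with polynomial coefficients; hence the first few of them
   solve a linear system with rational coefficients and zero initial value on the reals. *)
Lemma poly_ode_identity (I : finType) (om : I -> C -> C) (g : I -> I -> {poly C})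
    (q : I -> {poly C}) :
  (forall i z, cder (om i) z (\sum_j (g i j).[z] * om j z)) ->
  (forall x : R, \sum_i (q i).[x%:C] * om i x%:C = 0) ->
  forall z, \sum_i (q i).[z] * om i z = 0.
Proof.
move=> dom q0.
(* [qs k] is the coefficient vector of the [k]-th derivative [phi k], by the product rule and the
   system for [om]. *)
pose qs := fix qs k := if k is k'.+1 then fun j => (qs k' j)^`() + \sum_i qs k' i * g i j else q.
pose phi k z := \sum_i (qs k i).[z] * om i z.
have dphi k z : cder (phi k) z (phi k.+1 z).
  apply: cder_ext (@cder_sum R I (index_enum I) xpredT (fun i z => (qs k i).[z] * om i z)
    z _ (fun i => cderM (cder_horner _ _) (dom i z))) => //.
  rewrite /phi big_split /=.
  transitivity (\sum_i (qs k i)^`().[z] * om i z + \sum_i \sum_j (qs k i * g i j).[z] * om j z).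
    congr (_ + _); apply: eq_bigr => i _; rewrite mulr_sumr; apply: eq_bigr => j _.
    by rewrite mulrA hornerM.
  rewrite exchange_big -big_split /=; apply: eq_bigr => j _.
  by rewrite hornerD mulrDl horner_sum mulr_suml.
have phi0 k (x : R) : phi k x%:C = 0.
  elim: k x => [|k IH] x; first exact: q0.
  exact: (cder_zero_on_reals (dphi k) IH).
pose d := #|I|.
(* The added zero column makes the matrix square and singular, so its [d + 1] rows are linearly
   dependent over the polynomials. *)
pose A : 'M[{poly C}]_d.+1 :=
  \matrix_(k, j) if unlift ord_max j is Some j' then qs k (enum_val j') else 0.
have /det0P[v v0 vA] : \det A == 0.
  apply/eqP; rewrite (expand_det_col A ord_max) big1 // => i _.
  by rewrite mxE unlift_none mul0r.
have rel i : \sum_(k < d.+1) v 0 k * qs k i = 0.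
  have := congr1 (fun M : 'rV__ => M 0 (lift ord_max (enum_rank i))) vA.
  rewrite /= mxE [RHS]mxE => H; rewrite -[RHS]H; apply: eq_bigr => k _.
  by rewrite mxE liftK enum_rankK.
have relphi z : \sum_(k < d.+1) (v 0 k).[z] * phi k z = 0.
  transitivity (\sum_i (\sum_(k < d.+1) v 0 k * qs k i).[z] * om i z).
    rewrite /phi; under eq_bigr do rewrite mulr_sumr.
    rewrite exchange_big /=; apply: eq_bigr => i _; rewrite horner_sum mulr_suml.
    by apply: eq_bigr => k _; rewrite hornerM mulrA.
  by rewrite big1 // => i _; rewrite rel horner0 mul0r.
have [k0 vk0] : exists k, v 0 k != 0 by apply/existsP; apply: contraNT v0 => /existsPn H;
  apply/eqP/rowP => j; rewrite mxE; apply/eqP; have := H j; rewrite negbK.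
(* With [K] the largest index of a nonzero coefficient, the relation expresses [phi K] through the
   lower derivatives, wherever the pivot [v 0 K] does not vanish. *)
case: (@arg_maxnP _ k0 (fun k => v 0 k != 0) (fun k => k : nat) vk0) => K vK Kmax.
have relK z : (v 0 K).[z] * phi K z = - \sum_(j < K) (v 0 (inord j)).[z] * phi j z.
  have := relphi z; rewrite (bigD1 K) //= => /eqP; rewrite addr_eq0 => /eqP ->; congr (- _).
  apply: esym.
  rewrite (big_ord_widen d.+1 (fun k => (v 0 (inord k)).[z] * phi k z)) 1?ltnW //.
  rewrite big_mkcond [RHS]big_mkcond /=; apply: eq_bigr => k _; rewrite inord_val.
  case: ltngtP => [kK|Kk|/val_inj ->]; rewrite ?eqxx //.
    by rewrite -val_eqE /= ltn_eqF.
  rewrite -val_eqE /= gtn_eqF //.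
  have [->|/Kmax] := eqVneq (v 0 k) 0; first by rewrite horner0 mul0r.
  by rewrite /= leqNgt Kk.
(* Points on the vertical lines through the roots of the pivot are set aside; [cder_dense] recovers
   them by continuity. *)
have [r vr] := closed_field_poly_normal (v 0 K).
have vr0 w : complex.Re w \notin [seq complex.Re x | x <- r] -> (v 0 K).[w] != 0.
  move=> wr; apply: contra wr; rewrite -rootE vr rootZ ?lead_coef_eq0 // root_prod_XsubC.
  exact: map_f.
move=> z0; suff H z : complex.Re z \notin [seq complex.Re x | x <- r] -> phi 0%N z = 0.
  exact: (cder_dense (dphi 0%N z0) H).
move=> zr.
(* The segment from the real part of [z] up to [z] is vertical, so it avoids the roots of the
   pivot. *)
have dz t : (v 0 K).[(complex.Re z)%:C + t%:C * ('i * (complex.Im z)%:C)] != 0.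
  apply: vr0; suff -> : complex.Re ((complex.Re z)%:C + t%:C * ('i * (complex.Im z)%:C)) =
    complex.Re z by [].
  by move: (z) => [z1 z2] /=; ring.
(* For [K = 0] there is no system: the relation itself says that the pivot times [phi 0]
   vanishes. *)
have [K0|K0] := posnP K.
  have := relK z; rewrite K0 big_ord0 oppr0 => /eqP; rewrite mulf_eq0 (negbTE (vr0 _ zr)) /=.
  by move=> /eqP.
(* The companion matrix of the relation: each [phi i] has derivative [phi (i + 1)], and the last row
   substitutes for [phi K]. *)
pose m (i j : 'I_K) w : C := if i.+1 == K then - (v 0 (inord j)).[w] * ((v 0 K).[w])^-1
  else (j == i.+1 :> nat)%:R.
have := @linear_ode_zero R K (fun i => phi i) (fun i => phi i.+1) m (complex.Re z)%:C
  ('i * (complex.Im z)%:C).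
rewrite -complexE => /(_ _ _ _ _ (Ordinal K0)); apply => //.
- move=> t _ i; set w := _ + _; rewrite /m; case: eqP => [iK|/eqP iK].
    rewrite iK; apply: (mulfI (dz t)); rewrite relK mulr_sumr -sumrN; apply: eq_bigr => j _.
    by field; exact: dz t.
  have iK1 : (i.+1 < K)%N by rewrite ltn_neqAle iK ltn_ord.
  rewrite (bigD1 (Ordinal iK1)) //= eqxx mul1r big1 ?addr0 // => j.
  by rewrite -val_eqE /= => /negbTE ->; rewrite mul0r.
- move=> t _ i j; rewrite /m; case: eqP => _; last by exists 0; exact: cder_cst.
  eexists; apply: cderM (cder_inv (dz t) (cder_horner _ _)).
  by apply: cder_ext (cderM (cder_cst (-1) _) (cder_horner _ _)) => // w; rewrite mulN1r.
Qed.

End LinearODE.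

(** * Extension of unitarity from the line to the plane *)

Section UnitaryExtension.
Context (R : realType) (N : nat).
Local Notation C := R[i].
Local Notation mpoly := {poly 'M[C]_N.+1}.

Definition entryp (K : mpoly) i k : {poly C} := \poly_(m < size K) (K`_m) i k.

Lemma entrypE (K : mpoly) i k z : (entryp K i k).[z] = mpeval K z i k.
Proof.
rewrite (mpevalE _ (leqnn _)) summxE horner_poly; apply: eq_bigr => m _.
by rewrite mxE mulrC.
Qed.

(** The matrix, indexed by pairs, of the linear operator taking [M] to [K M + M K#]. The entries of
    [K#] come from conjugated coefficients. *)
Definition lyap (K : mpoly) (ab kl : 'I_N.+1 * 'I_N.+1) : {poly C} :=
  (if kl.2 == ab.2 then entryp K ab.1 kl.1 else 0) +
  (if kl.1 == ab.1 then map_poly conjc (entryp K ab.2 kl.2) else 0).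

Lemma sum_lyap (K : mpoly) z (M : 'M[C]_N.+1) ab :
  \sum_kl (lyap K ab kl).[z] * M kl.1 kl.2 =
  (mpeval K z *m M + M *m adjf (mpeval K) z) ab.1 ab.2.
Proof.
rewrite -(pair_bigA _ (fun k l => (lyap K ab (k, l)).[z] * M k l)) /= mxE.
under eq_bigr do under eq_bigr do rewrite /lyap hornerD mulrDl.
under eq_bigr do rewrite big_split.
rewrite big_split /= !mxE; congr (_ + _).
  apply: eq_bigr => k _; rewrite (bigD1 ab.2) //= eqxx entrypE big1 ?addr0 // => l.
  by move=> /negbTE ->; rewrite horner0 mul0r.
rewrite exchange_big /=; apply: eq_bigr => l _.
rewrite (bigD1 ab.1) //= eqxx big1 ?addr0 => [|k /negbTE ->]; last by rewrite horner0 mul0r.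
by rewrite !mxE -{1}[z]conjcK horner_map entrypE mulrC.
Qed.

(** Entrywise the claim is a polynomial combination of the entries of [Om], which solve the linear
    system with matrix [lyap G]; so [poly_ode_identity] applies. *)
Lemma skew_extension (G H : mpoly) (Om : C -> 'M[C]_N.+1) :
  (forall z, is_cderive Om z (mpeval G z *m Om z + Om z *m adjf (mpeval G) z)) ->
  (forall x : R, mpeval H x%:C *m Om x%:C + Om x%:C *m adjf (mpeval H) x%:C = 0) ->
  forall z, mpeval H z *m Om z + Om z *m adjf (mpeval H) z = 0.
Proof.
move=> dOm H0 z; apply/matrixP => a b; rewrite [RHS]mxE -(sum_lyap H z (Om z) (a, b)).
apply: (poly_ode_identity (om := fun kl w => Om w kl.1 kl.2) (g := lyap G)) => [kl w|x].
  by rewrite sum_lyap; exact: dOm.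
by rewrite sum_lyap H0 mxE.
Qed.

(** The difference to the value at [b] solves the zero system along the segment from [b] to [a]. *)
Lemma is_cderive0_cst p q (F : C -> 'M[C]_(p, q)) a b :
  (forall z, is_cderive F z 0) -> F a = F b.
Proof.
move=> dF; apply/matrixP => i j; apply/eqP; rewrite -subr_eq0; apply/eqP.
have := @linear_ode_zero R 1 (fun _ z => F z i j - F b i j) (fun _ _ => 0) (fun _ _ _ => 0)
  b (a - b).
rewrite [b + _]addrC subrK; apply; last exact: ord0.
- move=> _ z; have := cderD (dF z i j) (cder_cst (- F b i j) z).
  by rewrite mxE addr0.
- by move=> t _ _; rewrite big_ord1 mul0r.
- by move=> t _ _ _; exists 0; exact: cder_cst.
- by move=> _; rewrite subrr.
Qed.

(** With [Om = T T#] one has [H Om + Om H# = T (chi + chi#) T#]. On the line [S S# = 1], so the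
    derivative [chi + chi#] of [S S#] vanishes there. [skew_extension] carries this to the plane,
    where [S S#] is therefore constant. *)
Lemma unitary_extension (T S : C -> 'M[C]_N.+1) (G H : mpoly) :
  (forall z, is_cderive T z (mpeval G z *m T z)) ->
  (forall z, T z \in unitmx) ->
  entire S -> (forall x : R, S x%:C \is unitarymx) ->
  (forall z, mpeval H z = T z *m cderiv S z *m adjf S z *m invmx (T z)) ->
  [/\ forall z, is_cderive S z (cderiv S z),
      forall z, mpeval H z *m (T z *m adjf T z) + T z *m adjf T z *m adjf (mpeval H) z = 0 &
      forall z, adjf S z *m S z = 1%:M].
Proof.
move=> dT uT eS uS HE.
have dS z : is_cderive S z (cderiv S z).
  by move=> i j; rewrite mxE; apply: DeriveDef => //; exact: eS.
pose chi z := cderiv S z *m adjf S z.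
pose U z := S z *m adjf S z.
have adjchi z : adjf chi z = S z *m (cderiv S z^*)^t*.
  by rewrite /adjf /chi trmxCM /adjf trmxCK conjcK.
have dU z : is_cderive U z (chi z + adjf chi z).
  by rewrite adjchi; apply: is_cderiveM (dS z) _; exact/is_cderive_adjf.
have U1 (x : R) : U x%:C = 1%:M by rewrite /U /adjf conjc_real; exact/unitarymxP.
have chi0 (x : R) : chi x%:C + adjf chi x%:C = 0.
  apply/matrixP => i j; rewrite [RHS]mxE.
  apply: (cder_zero_on_reals (f := fun z => U z i j - (i == j)%:R)
     (f' := fun z => (chi z + adjf chi z) i j)) => [z|y].
    by have := cderD (dU z i j) (cder_cst (- (i == j)%:R) z); rewrite addr0.
  by rewrite U1 mxE subrr.
have Hchi z : mpeval H z = T z *m chi z *m invmx (T z) by rewrite HE !mulmxA.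
have dadjT z : is_cderive (adjf T) z (adjf T z *m adjf (mpeval G) z).
  rewrite -adjfM; exact/is_cderive_adjf.
pose Om z := T z *m adjf T z.
have adj3 (A B D : 'M[C]_N.+1) : (A *m B *m invmx D)^t* = invmx (D^t*) *m (B^t* *m A^t*).
  by rewrite !trmxCM trmxCV.
have HOm z : mpeval H z *m Om z + Om z *m adjf (mpeval H) z =
    T z *m (chi z + adjf chi z) *m adjf T z.
  have -> : adjf (mpeval H) z = invmx (adjf T z) *m adjf chi z *m adjf T z.
    by rewrite {1}/adjf Hchi adj3 mulmxA.
  have uT' : adjf T z \in unitmx by rewrite /adjf map_unitmx unitmx_tr.
  rewrite Hchi /Om mulmxDr mulmxDl; congr (_ + _); first by rewrite !mulmxA mulmxKV.
  by rewrite !mulmxA mulmxK.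
have skew z : chi z + adjf chi z = 0.
  have := @skew_extension G H Om _ _ z; rewrite HOm.
  move=> /(_ _ _)/(congr1 (fun A => invmx (T z) *m A *m invmx (adjf T z))).
  have uT' : adjf T z \in unitmx by rewrite /adjf map_unitmx unitmx_tr.
  rewrite mulmxA mulKmx // mulmxK // mulmx0 mul0mx; apply => [w|x].
    apply: is_cderive_ext (is_cderiveM (dT w) (dadjT w)) => //.
    by rewrite /Om !mulmxA.
  by rewrite HOm chi0 mulmx0 mul0mx.
have UE z : U z = 1%:M.
  rewrite -(U1 0); apply: is_cderive0_cst => w.
  by rewrite -(skew w); exact: dU.
split=> // z; last exact/mulmx1C/UE.
by have := HOm z; rewrite skew mulmx0 mul0mx.
Qed.

End UnitaryExtension.

(** * Complex-valued integrals on the line *)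

Section ComplexIntegral.
Context (R : realType).
Local Notation C := R[i].
Local Notation mu := (@lebesgue_measure R).
Local Notation rint f := (mu.-integrable setT (EFin \o (f : R -> R))).

Lemma ReD (x y : C) : complex.Re (x + y) = complex.Re x + complex.Re y.
Proof. by case: x y => ? ? []. Qed.

Lemma ImD (x y : C) : complex.Im (x + y) = complex.Im x + complex.Im y.
Proof. by case: x y => ? ? []. Qed.

Lemma rintD (f g : R -> R) : rint f -> rint g -> rint (fun x => f x + g x).
Proof. by move=> hf hg; have := integrableD measurableT hf hg. Qed.

Lemma rintZ (k : R) (f : R -> R) : rint f -> rint (fun x => k * f x).
Proof. by move=> hf; have := integrableZl measurableT k hf. Qed.

Lemma rint_le (f g : R -> R) : measurable_fun setT f -> (forall x, `|f x| <= g x) ->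
  rint g -> rint f.
Proof.
move=> mf fg; apply: le_integrable => //; first exact/measurable_EFinP.
by move=> x _ /=; rewrite lee_fin (le_trans (fg x)) // ler_norm.
Qed.

Lemma rint_measurable (f : R -> R) : rint f -> measurable_fun setT f.
Proof. by move=> /measurable_int /measurable_EFinP. Qed.

Definition cintegrable (f : R -> C) : Prop :=
  rint (fun x => complex.Re (f x)) /\ rint (fun x => complex.Im (f x)).

Lemma eq_cintegrable (f g : R -> C) : f =1 g -> cintegrable f -> cintegrable g.
Proof. by move=> /funext ->. Qed.

Lemma cintegrable0 : cintegrable (fun=> 0).
Proof. by split; exact: integrable0. Qed.

Lemma cintegrableD f g : cintegrable f -> cintegrable g -> cintegrable (fun x => f x + g x).
Proof.
move=> [f1 f2] [g1 g2]; split.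
  by apply: eq_integrable (rintD f1 g1) => // x _ /=; rewrite ReD.
by apply: eq_integrable (rintD f2 g2) => // x _ /=; rewrite ImD.
Qed.

Lemma cintegrableZ c f : cintegrable f -> cintegrable (fun x => c * f x).
Proof.
move=> [f1 f2]; split.
  apply: eq_integrable (rintD (rintZ (complex.Re c) f1) (rintZ (- complex.Im c) f2)) => // x _ /=.
  by rewrite ReM mulNr.
apply: eq_integrable (rintD (rintZ (complex.Re c) f2) (rintZ (complex.Im c) f1)) => // x _ /=.
by rewrite ImM.
Qed.

Lemma cintegrable_sum (I : Type) (r : seq I) (P : pred I) (f : I -> R -> C) :
  (forall i, cintegrable (f i)) -> cintegrable (fun x => \sum_(i <- r | P i) f i x).
Proof.
move=> hf; elim: r => [|i r IH].
  by apply: eq_cintegrable cintegrable0 => x; rewrite big_nil.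
apply: (@eq_cintegrable (fun x => (if P i then f i x else 0) + \sum_(i <- r | P i) f i x)).
  by move=> x; rewrite big_cons; case: (P i); rewrite ?add0r.
by apply: cintegrableD => //; case: (P i) => //; exact: cintegrable0.
Qed.

Lemma cintegralD f g : cintegrable f -> cintegrable g ->
  cintegral (fun x => f x + g x) = cintegral f + cintegral g.
Proof.
move=> [f1 f2] [g1 g2]; rewrite /cintegral.
under eq_Rintegral do rewrite ReD.
under [X in _ +i* X]eq_Rintegral do rewrite ImD.
by rewrite !RintegralD.
Qed.

Lemma cintegralZ c f : cintegrable f -> cintegral (fun x => c * f x) = c * cintegral f.
Proof.
move=> [f1 f2]; rewrite /cintegral.
under eq_Rintegral do rewrite ReM.
under [X in _ +i* X]eq_Rintegral do rewrite ImM.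
rewrite RintegralB ?RintegralD ?RintegralZl //; try exact: rintZ.
by case: c.
Qed.

Lemma cintegral0 : cintegral (fun=> 0 : C) = 0.
Proof. by rewrite /cintegral /Rintegral /= integral0. Qed.

Lemma cintegral_sum (I : Type) (r : seq I) (P : pred I) (f : I -> R -> C) :
  (forall i, cintegrable (f i)) ->
  cintegral (fun x => \sum_(i <- r | P i) f i x) = \sum_(i <- r | P i) cintegral (f i).
Proof.
move=> hf; elim: r => [|i r IH].
  by rewrite big_nil -[RHS]cintegral0; congr cintegral; apply/funext => x; rewrite big_nil.
rewrite big_cons -IH; case Pi : (P i).
  rewrite -cintegralD //; last exact: cintegrable_sum.
  by congr cintegral; apply/funext => x; rewrite big_cons Pi.
by congr cintegral; apply/funext => x; rewrite big_cons Pi.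
Qed.

Lemma cintegral_conj f : cintegrable f -> cintegral (fun x => (f x)^*) = (cintegral f)^*.
Proof.
move=> [f1 f2]; rewrite /cintegral /=; congr (_ +i* _).
  by apply: eq_Rintegral => x _; case: (f x).
rewrite -mulN1r -RintegralZl //; apply: eq_Rintegral => x _.
by rewrite mulN1r; case: (f x).
Qed.

(** Equivalent to the usual norm of [L^1], but built from integrals of the real and imaginary parts
    separately. *)
Definition l1norm (f : R -> C) : R :=
  \int[mu]_x `|complex.Re (f x)| + \int[mu]_x `|complex.Im (f x)|.

Lemma norm_ReIm (z : C) : complex.Re `|z| <= `|complex.Re z| + `|complex.Im z|.
Proof.
have := ler_normD (complex.Re z)%:C ('i * (complex.Im z)%:C).
by rewrite -complexE normrM norm_i mul1r !normc_real -rmorphD normcR lecR.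
Qed.

Lemma norm_cintegral f : cintegrable f -> complex.Re `|cintegral f| <= l1norm f.
Proof.
move=> [f1 f2]; apply: le_trans (norm_ReIm _) _.
by apply: lerD; exact: le_normr_Rintegral.
Qed.

Definition cmeasurable (f : R -> C) : Prop :=
  measurable_fun setT (fun x => complex.Re (f x)) /\
  measurable_fun setT (fun x => complex.Im (f x)).

Lemma cmeasurableM f g : cmeasurable f -> cmeasurable g -> cmeasurable (fun x => f x * g x).
Proof.
move=> [f1 f2] [g1 g2]; split.
  under eq_fun do rewrite ReM; apply: measurable_funB; exact: measurable_funM.
under eq_fun do rewrite ImM; apply: measurable_funD; exact: measurable_funM.
Qed.

Lemma cintegrable_dom (f : R -> C) (g : R -> R) : cmeasurable f ->
  (forall x, complex.Re `|f x| <= g x) -> rint g -> cintegrable f.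
Proof.
move=> [f1 f2] fg hg; split; apply: rint_le hg => // x; apply: le_trans (fg x).
  exact: normRe.
exact: normIm.
Qed.

(** The real and the imaginary part of the product are each at most [B (|Re f| + |Im f|)], whence
    the factor 2. *)
Lemma cintegrable_bounded (r f : R -> C) (B : R) : cmeasurable r ->
  (forall x, complex.Re `|r x| <= B) -> cintegrable f ->
  cintegrable (fun x => r x * f x) /\ l1norm (fun x => r x * f x) <= 2 * B * l1norm f.
Proof.
move=> mr rB hf; have [f1 f2] := hf.
have B0 : 0 <= B := le_trans (Re_norm_ge0 _) (rB 0).
pose g x := B * (`|complex.Re (f x)| + `|complex.Im (f x)|).
have hg : rint g by apply: rintZ; apply: rintD; exact: integrable_norm.
have le x : complex.Re `|r x * f x| <= g x.
  rewrite normrM (normcR (r x)) (normcR (f x)) -rmorphM /=.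
  by apply: ler_pM (rB x) (norm_ReIm _); exact: Re_norm_ge0.
have mf : cmeasurable f by split; exact: rint_measurable.
have hrf := cintegrable_dom (cmeasurableM mr mf) le hg.
split=> //.
have [h1 h2] := hrf.
have -> : 2 * B * l1norm f = \int[mu]_x g x + \int[mu]_x g x.
  rewrite /g RintegralZl //; last by apply: rintD; exact: integrable_norm.
  by rewrite RintegralD //; [rewrite /l1norm; ring|exact: integrable_norm..].
apply: lerD; apply: le_Rintegral => //; try exact: integrable_norm.
  by move=> x _; apply: le_trans (normRe _) (le x).
by move=> x _; apply: le_trans (normIm _) (le x).
Qed.

End ComplexIntegral.

(** * Multipliers of polynomial growth and Cauchy transforms *)

Section Tame.
Context (R : realType).
Local Notation C := R[i].
Local Notation mu := (@lebesgue_measure R).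
Local Notation rint f := (mu.-integrable setT (EFin \o (f : R -> R))).

(** These multipliers turn functions with finite moments into integrable ones. The base [1 + t ^ 2]
    is at least 1, so the bounds grow with the exponent and combine under sums and products. *)
Definition tame (r : R -> C) : Prop :=
  cmeasurable r /\
  exists (M : R) (k : nat), forall t, complex.Re `|r t| <= M * (1 + t ^+ 2) ^+ k.

Lemma eq_tame (f g : R -> C) : f =1 g -> tame f -> tame g.
Proof. by move=> /funext ->. Qed.

Lemma tame_ge0 (r : R -> C) M k :
  (forall t, complex.Re `|r t| <= M * (1 + t ^+ 2) ^+ k) -> 0 <= M.
Proof.
move=> /(_ 0); rewrite expr0n addr0 expr1n mulr1; exact/le_trans/Re_norm_ge0.
Qed.

Lemma ge1_sqr (t : R) : 1 <= 1 + t ^+ 2.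
Proof. by rewrite lerDl sqr_ge0. Qed.

Lemma Re_normD (x y : C) : complex.Re `|x + y| <= complex.Re `|x| + complex.Re `|y|.
Proof.
by have := ler_normD x y; rewrite (normcR (x + y)) (normcR x) (normcR y) -rmorphD lecR.
Qed.

Lemma Re_normM (x y : C) : complex.Re `|x * y| = complex.Re `|x| * complex.Re `|y|.
Proof. by rewrite normrM (normcR x) (normcR y) -rmorphM. Qed.

Lemma Re_normMr (x : C) (y : R) : complex.Re `|x * y%:C| = complex.Re `|x| * `|y|.
Proof. by rewrite Re_normM normc_real. Qed.

Lemma tame_cst c : tame (fun=> c).
Proof.
split; first by split; exact: measurable_cst.
by exists (complex.Re `|c|), 0%N => t; rewrite expr0 mulr1.
Qed.

Lemma tame_id : tame (fun t => t%:C).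
Proof.
split; first by split; [exact: measurable_id|exact: measurable_cst].
exists 1, 1%N => t; rewrite normc_real expr1 mul1r /= ler_norml.
by apply/andP; split; nra.
Qed.

Lemma tameD f g : tame f -> tame g -> tame (fun t => f t + g t).
Proof.
move=> [[f1 f2] [M [k Mf]]] [[g1 g2] [M' [k' Mg]]]; split.
  split; first by under eq_fun do rewrite ReD; exact: measurable_funD.
  by under eq_fun do rewrite ImD; exact: measurable_funD.
exists (M + M'), (k + k')%N => t.
apply: le_trans (Re_normD _ _) _.
rewrite mulrDl; apply: lerD; [apply: le_trans (Mf t) _|apply: le_trans (Mg t) _].
  by rewrite ler_wpM2l ?(tame_ge0 Mf) // ler_weXn2l ?ge1_sqr // leq_addr.
by rewrite ler_wpM2l ?(tame_ge0 Mg) // ler_weXn2l ?ge1_sqr // leq_addl.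
Qed.

Lemma tameM f g : tame f -> tame g -> tame (fun t => f t * g t).
Proof.
move=> [mf [M [k Mf]]] [mg [M' [k' Mg]]]; split; first exact: cmeasurableM.
exists (M * M'), (k + k')%N => t.
by rewrite Re_normM exprD mulrACA; apply: ler_pM (Mf t) (Mg t); exact: Re_norm_ge0.
Qed.

Lemma tame_conj f : tame f -> tame (fun t => (f t)^*).
Proof.
move=> [[f1 f2] [M [k Mf]]]; split; last by exists M, k => t; rewrite normcJ.
split; first by have -> : (fun t => complex.Re (f t)^*) = (fun t => complex.Re (f t))
  by apply/funext => t; case: (f t).
have -> : (fun t => complex.Im (f t)^*) = (fun t => - complex.Im (f t))
  by apply/funext => t; case: (f t).
exact: measurable_funN.
Qed.

Lemma tame_sum (I : Type) (r : seq I) (P : pred I) (f : I -> R -> C) :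
  (forall i, tame (f i)) -> tame (fun t => \sum_(i <- r | P i) f i t).
Proof.
move=> hf; elim: r => [|i r IH].
  by apply: eq_tame (tame_cst 0) => t; rewrite big_nil.
apply: (@eq_tame (fun x => (if P i then f i x else 0) + \sum_(i <- r | P i) f i x)).
  by move=> t; rewrite big_cons; case: (P i); rewrite ?add0r.
by apply: tameD => //; case: (P i) => //; exact: tame_cst.
Qed.

Lemma tameX f k : tame f -> tame (fun t => f t ^+ k).
Proof.
move=> hf; elim: k => [|k IH]; first by apply: eq_tame (tame_cst 1) => t.
by apply: eq_tame (tameM hf IH) => t; rewrite exprS.
Qed.

Lemma subc_neq0 (z : C) (t : R) : complex.Im z != 0 -> t%:C - z != 0.
Proof.
apply: contraNneq => /eqP; rewrite subr_eq0 => /eqP <- //.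
Qed.

(** A real [t] has distance at least [|Im z|] from [z]. *)
Lemma norm_resolvent (z : C) (t : R) : complex.Im z != 0 ->
  complex.Re `|(t%:C - z)^-1| <= `|complex.Im z|^-1.
Proof.
move=> z0; have tz := subc_neq0 t z0.
rewrite normfV (normcR (_ - _)) -fmorphV /=.
have Im0 : 0 < `|complex.Im z| by rewrite normr_gt0.
have le : `|complex.Im z| <= complex.Re `|t%:C - z|.
  apply: le_trans (normIm _); rewrite ImD /= add0r.
  by case: (z) => ? ? /=; rewrite normrN.
by rewrite lef_pV2 ?posrE // (lt_le_trans Im0).
Qed.

Lemma cder_resolvent (z w : C) : w - z != 0 ->
  cder (fun w => (w - z)^-1) w (- ((w - z)^-1) ^+ 2).
Proof.
move=> wz; have := @cder_inv R (fun w => w - z) w _ wz (cderD (cder_id w) (cder_cst (- z) w)).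
by rewrite addr0 mulr1 exprVn.
Qed.

Lemma is_derive_continuous (f f' : R -> R) :
  (forall t, is_derive (t : R^o) (1 : R^o) (f : R^o -> R^o) (f' t)) -> continuous f.
Proof.
move=> df t; apply: differentiable_continuous; apply/derivable1_diffP.
by have [] := df t.
Qed.

Lemma cder_continuous_real (f : C -> C) : (forall t : R, exists l, cder f t%:C l) ->
  continuous (fun t : R => complex.Re (f t%:C)) /\ continuous (fun t : R => complex.Im (f t%:C)).
Proof.
move=> /choice[l hl]; split.
  exact: (is_derive_continuous (fun t => (is_derive_real (hl t)).1)).
exact: (is_derive_continuous (fun t => (is_derive_real (hl t)).2)).
Qed.

Lemma cmeasurable_resolvent (z : C) : complex.Im z != 0 ->
  cmeasurable (fun t => (t%:C - z)^-1).
Proof.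
move=> z0; have [|c1 c2] := @cder_continuous_real (fun w => (w - z)^-1).
  by move=> t; eexists; apply: cder_resolvent; exact: subc_neq0.
by split; exact: continuous_measurable_fun.
Qed.

Lemma tame_resolvent (z : C) : complex.Im z != 0 -> tame (fun t => (t%:C - z)^-1).
Proof.
move=> z0; split; first exact: cmeasurable_resolvent.
by exists `|complex.Im z|^-1, 0%N => t; rewrite expr0 mulr1 norm_resolvent.
Qed.

Lemma finite_moments_sqr (w : R -> R) k : finite_moments w ->
  finite_moments (fun t => (1 + t ^+ 2) ^+ k * w t).
Proof.
elim: k => [|k IH] hw.
  by move=> j; apply: eq_integrable (hw j) => // x _ /=; rewrite expr0 mul1r.
move=> j; apply: eq_integrable (rintD (IH hw j) (IH hw j.+2)) => // x _ /=.
by congr EFin; rewrite !exprS; ring.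
Qed.

Lemma tame_integrable (r : R -> C) (w : R -> R) : tame r -> finite_moments w ->
  cintegrable (fun t => r t * (w t)%:C).
Proof.
move=> [mr [M [k Mr]]] hw.
have hk := finite_moments_sqr k hw 0.
have hw0 : rint w by apply: eq_integrable (hw 0%N) => // x _ /=; rewrite mul1r.
apply: (@cintegrable_dom _ _ (fun t => M * `|(1 + t ^+ 2) ^+ k * w t|)).
- by apply: cmeasurableM => //; split; [exact: rint_measurable|exact: measurable_cst].
- move=> t; rewrite Re_normMr normrM mulrA.
  rewrite ler_wpM2r // (@ger0_norm _ ((1 + t ^+ 2) ^+ k)) ?Mr // exprn_ge0 //.
  exact: le_trans ler01 (ge1_sqr t).
- apply: rintZ; apply: integrable_norm.
  by apply: eq_integrable hk => // x _ /=; rewrite mul1r.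
Qed.

(* Differentiation under the integral sign: the second-order remainder is
   [h / ((t - z)^2 (t - z - h))], so no dominated convergence is needed. *)
Lemma cder_cauchy (f : R -> C) (z : C) : cintegrable f -> complex.Im z != 0 ->
  cder (fun z => cintegral (fun t => (t%:C - z)^-1 * f t)) z
    (cintegral (fun t => ((t%:C - z)^-1) ^+ 2 * f t)).
Proof.
(* For [|h| < e] the point [z + h] still has distance at least [e] from the line, so [1 / e] bounds
   the resolvents at [z] and at [z + h]; the remainder kernel is a product of three of them. *)
move=> hf z0; pose e := `|complex.Im z| / 2.
have e0 : 0 < e by rewrite divr_gt0 // normr_gt0.
apply: (@cder_lip _ _ _ _ (2 * (e^-1 * e^-1 * e^-1) * l1norm f)%:C e%:C).
  by rewrite ltcR.
move=> h h0; rewrite (normcR h) ltcR => he.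
have Imzh : e <= `|complex.Im (h + z)|.
  rewrite ImD; have := normIm h; have := ler_normB (complex.Im h + complex.Im z) (complex.Im h).
  rewrite addrC addKr; move: he; rewrite /e.
  set a := `|complex.Im z|; set b := `|_ + _|; set c := complex.Re _; set d := `|_| => *.
  lra.
have zh0 : complex.Im (h + z) != 0 by rewrite -normr_gt0 (lt_le_trans e0).
have bd1 t : complex.Re `|(t%:C - z)^-1| <= e^-1.
  apply: le_trans (norm_resolvent t z0) _; rewrite lef_pV2 ?posrE ?normr_gt0 // /e.
  by rewrite ler_pdivrMr // ler_peMr // ler1n.
have bd2 t : complex.Re `|(t%:C - (h + z))^-1| <= e^-1.
  by apply: le_trans (norm_resolvent t zh0) _; rewrite lef_pV2 ?posrE ?normr_gt0.
have m1 := cmeasurable_resolvent z0; have m2 := cmeasurable_resolvent zh0.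
have [i1 _] := cintegrable_bounded m1 bd1 hf.
have [i2 _] := cintegrable_bounded m2 bd2 hf.
have [i11 _] := cintegrable_bounded m1 bd1 i1.
pose k t := (t%:C - z)^-1 * (t%:C - z)^-1 * (t%:C - (h + z))^-1.
have mk : cmeasurable k by apply: cmeasurableM => //; exact: cmeasurableM.
have bk t : complex.Re `|k t| <= e^-1 * e^-1 * e^-1.
  rewrite !Re_normM; apply: ler_pM => //; rewrite ?mulr_ge0 ?Re_norm_ge0 //.
  by apply: ler_pM => //; exact: Re_norm_ge0.
have [ik lk] := cintegrable_bounded mk bk hf.
have -> : h^-1 * (cintegral (fun t => (t%:C - (h + z))^-1 * f t) -
    cintegral (fun t => (t%:C - z)^-1 * f t)) -
    cintegral (fun t => (t%:C - z)^-1 ^+ 2 * f t) = h * cintegral (fun t => k t * f t).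
  have -> : (fun t => (t%:C - z)^-1 ^+ 2 * f t) = (fun t => (t%:C - z)^-1 * ((t%:C - z)^-1 * f t)).
    by apply/funext => t; rewrite expr2 mulrA.
  have sub (u v : R -> C) : cintegrable u -> cintegrable v ->
      cintegral u - cintegral v = cintegral (fun t => u t + (-1) * v t).
    by move=> hu hv; rewrite cintegralD ?cintegralZ ?mulN1r //; exact: cintegrableZ.
  rewrite sub // -!cintegralZ //; last by apply: cintegrableD => //; exact: cintegrableZ.
  rewrite sub //; last by apply: cintegrableZ; apply: cintegrableD => //; exact: cintegrableZ.
  congr cintegral; apply/funext => t; rewrite /k.
  by field; rewrite h0 (subc_neq0 t z0) (subc_neq0 t zh0).
rewrite normrM mulrC ler_wpM2r // (normcR (cintegral _)) lecR.
exact: le_trans (norm_cintegral ik) lk.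
Qed.

End Tame.

(** * Integration by parts on the line *)

Section ImproperIntegral.
Context (R : realType).
Local Notation C := R[i].
Local Notation mu := (@lebesgue_measure R).
Local Notation rint f := (mu.-integrable setT (EFin \o (f : R -> R))).

(** Otherwise the integral of [|g|] over [D] would be at least [e] times an infinite measure. *)
Lemma integrable_small (g : R -> R) (e : R) (D : set R) : rint g -> 0 < e ->
  measurable D -> mu D = +oo%E -> exists2 x, D x & `|g x| < e.
Proof.
move=> hg e0 mD Doo; apply: contrapT => H.
have ge x : D x -> e <= `|g x|.
  by move=> Dx; rewrite leNgt; apply/negP => gx; apply: H; exists x.
have /integrableP[mg] : mu.-integrable D (EFin \o g) by apply: integrableS hg.
apply/negP; rewrite -leNgt.
have <- : (\int[mu]_(x in D) e%:E = +oo)%E.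
  transitivity (e%:E * mu D)%E; first exact: integral_cst.
  by rewrite Doo gt0_muley.
apply: ge0_le_integral => //.
  by move=> x _; rewrite lee_fin ltW.
exact: (measurableT_comp (@abse_measurable _ setT) mg).
Qed.

(** By [integrable_small] there are points [x n] beyond [n + 1] and [y n] below [- (n + 1)] where
    [g] is smaller than [1 / (n + 1)]. The fundamental theorem on [[y n, x n]] and dominated
    convergence give the integral as the limit of [g (x n) - g (y n)]. *)
Lemma integral_derive0 (g g' : R -> R) :
  (forall t, is_derive (t : R^o) (1 : R^o) (g : R^o -> R^o) (g' t)) ->
  continuous g' -> rint g -> rint g' -> \int[mu]_x g' x = 0.
Proof.
move=> dg cg' hg hg'.
have hx n : exists x, `[(n.+1%:R : R), +oo[%classic x /\ `|g x| < n.+1%:R^-1.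
  have [|//||x Dx gx] := @integrable_small g (n.+1%:R^-1) `[(n.+1%:R : R), +oo[%classic hg.
  - by rewrite invr_gt0.
  - by rewrite lebesgue_measure_itv /= ltry.
  - by exists x.
have hy n : exists y, `]-oo, (- n.+1%:R : R)]%classic y /\ `|g y| < n.+1%:R^-1.
  have [|//||y Dy gy] := @integrable_small g (n.+1%:R^-1) `]-oo, (- n.+1%:R : R)]%classic hg.
  - by rewrite invr_gt0.
  - by rewrite lebesgue_measure_itv /= ltNyr.
  - by exists y.
have /choice[x xP] := hx; have /choice[y yP] := hy.
have xn n : n.+1%:R <= x n by have [] := xP n; rewrite /= in_itv /= andbT.
have yn n : y n <= - n.+1%:R by have [] := yP n; rewrite /= in_itv.
have n0 n : 0 < n.+1%:R :> R by rewrite ltr0n.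
pose D n := `[y n, x n]%classic.
pose f_ n : R -> \bar R := (EFin \o g') \_ (D n).
have I n : (\int[mu]_t f_ n t = (g (x n) - g (y n))%:E)%E.
  rewrite -integral_mkcond EFinB.
  have yx : y n < x n.
    by apply: le_lt_trans (yn n) (lt_le_trans _ (xn n)); rewrite (lt_trans _ (n0 n)) // oppr_lt0.
  have gc t : {for t, continuous g} by apply: (is_derive_continuous dg).
  apply: (@continuous_FTC2 R g' g (y n) (x n) yx).
  - by apply: continuous_subspaceT => t; exact: cg'.
  - split=> [t _||]; first by have [] := dg t.
      exact/cvg_at_right_filter/gc.
    exact/cvg_at_left_filter/gc.
  - by move=> t _; rewrite derive1E; have [_ ->] := dg t.
have : (\int[mu]_t f_ n t)%E @[n --> \oo] --> (\int[mu]_t (EFin \o g') t)%E.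
  apply: (@dominated_cvg _ _ _ mu _ measurableT f_ (EFin \o g') (fun t => (`|g' t|)%:E)).
  - move=> n; apply/(measurable_restrictT _ _).1; first exact: measurable_itv.
    apply: measurable_funTS; exact: measurable_int hg'.
  - move=> t _; apply: cvg_near_cst.
    have [m tm] : exists m, `|t| < m%:R.
      by exists (Num.bound `|t|); exact: archi_boundP.
    exists m => // n /= mn; rewrite /f_ patchE ifT // inE /D /= in_itv /=.
    have tn : `|t| <= n.+1%:R by rewrite ltW // (lt_le_trans tm) // ler_nat (leq_trans mn).
    move: tn; rewrite ler_norml => /andP[t1 t2].
    by rewrite (le_trans (yn n) t1) (le_trans t2 (xn n)).
  - by [].
  - exact: integrable_norm hg'.
  - move=> n t _; rewrite /f_ patchE; case: ifP => _ /=; first by [].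
    by rewrite normr0 lee_fin.
under eq_fun do rewrite I.
have : (g (x n) - g (y n))%:E @[n --> \oo] --> (0 : R)%:E.
  apply: cvg_EFin; first by apply: nearW.
  apply/cvgrPdist_le => e e0.
  near=> n; rewrite /= sub0r normrN.
  apply: le_trans (ler_normB _ _) _.
  have [_ /ltW gx] := xP n; have [_ /ltW gy] := yP n.
  apply: le_trans (lerD gx gy) _.
  rewrite -mulr2n -[_ *+ 2]mulr_natl ler_pdivrMr // -ler_pdivrMl //.
  near: n; exists (Num.bound (e^-1 * 2)) => // n /= Hn.
  apply: le_trans (ltW (archi_boundP _)) _; first by rewrite mulr_ge0 // invr_ge0 ltW.
  by rewrite ler_nat (leq_trans Hn).
move=> c1 c2; have := cvg_unique _ c1 c2.
by rewrite /Rintegral => <-.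
Unshelve. all: by end_near.
Qed.

(* Integration by parts on the line; decay at infinity follows from integrability. *)
Lemma cintegral_parts (rho rho' : C -> C) (w w' : R -> R) :
  (forall t : R, cder rho t%:C (rho' t%:C)) ->
  (forall t : R, exists l, cder rho' t%:C l) ->
  tame (fun t => rho t%:C) -> tame (fun t => rho' t%:C) ->
  (forall t, is_derive (t : R^o) (1 : R^o) (w : R^o -> R^o) (w' t)) -> continuous w' ->
  finite_moments w -> finite_moments w' ->
  cintegral (fun t => rho t%:C * (w' t)%:C) = - cintegral (fun t => rho' t%:C * (w t)%:C).
Proof.
move=> drho drho' trho trho' dw cw' fw fw'.
have i1 := tame_integrable trho fw'; have i2 := tame_integrable trho' fw.
have i0 := tame_integrable trho fw.
have [c1 c2] := cder_continuous_real (fun t => ex_intro _ _ (drho t)).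
have [c1' c2'] := cder_continuous_real drho'.
have cw := is_derive_continuous dw.
(* Applied below to the real and to the imaginary part of [rho]; it is [integral_derive0] for the
   product [u w]. *)
have key (u u' : R -> R) : (forall t, is_derive (t : R^o) (1 : R^o) (u : R^o -> R^o) (u' t)) ->
    continuous u' -> rint (fun t => u t * w t) -> rint (fun t => u' t * w t) ->
    rint (fun t => u t * w' t) ->
    \int[mu]_t (u t * w' t) = - \int[mu]_t (u' t * w t).
  move=> du cu' h0 h1 h2; apply/eqP; rewrite -addr_eq0 -RintegralD //; apply/eqP.
  apply: (@integral_derive0 (fun t => u t * w t)) => //.
  - move=> t; apply: is_derive_eq (is_deriveM (du t) (dw t)) _.
    by rewrite /GRing.scale /= [w t * _]mulrC.
  - have cu := is_derive_continuous du.
    by move=> t; apply: cvgD; apply: cvgM; [exact: cu|exact: cw'|exact: cu'|exact: cw].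
  - exact: rintD.
have eRe (r : R -> C) (v : R -> R) :
    (fun t => complex.Re (r t * (v t)%:C)) = (fun t => complex.Re (r t) * v t).
  by apply/funext => t; rewrite ReM /= mulr0 subr0.
have eIm (r : R -> C) (v : R -> R) :
    (fun t => complex.Im (r t * (v t)%:C)) = (fun t => complex.Im (r t) * v t).
  by apply/funext => t; rewrite ImM /= mulr0 add0r.
move: i0 i1 i2; rewrite /cintegrable /cintegral.
rewrite !(eRe (fun t => rho t%:C)) !(eIm (fun t => rho t%:C)).
rewrite !(eRe (fun t => rho' t%:C)) !(eIm (fun t => rho' t%:C)).
move=> [a0 b0] [a1 b1] [a2 b2].
rewrite (key _ _ (fun t => (is_derive_real (drho t)).1)) //.
by rewrite (key _ _ (fun t => (is_derive_real (drho t)).2)).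
Qed.

End ImproperIntegral.

(** * Weighted matrix integrals *)

Section MatrixIntegral.
Context (R : realType).
Local Notation C := R[i].

Definition mxintegrable p q (F : R -> 'M[C]_(p, q)) : Prop :=
  forall i j, cintegrable (fun t => F t i j).

Lemma mxintegralD p q (F G : R -> 'M[C]_(p, q)) : mxintegrable F -> mxintegrable G ->
  mxintegral (fun t => F t + G t) = mxintegral F + mxintegral G.
Proof.
move=> hF hG; apply/matrixP => i j; rewrite !mxE -cintegralD //.
by congr cintegral; apply/funext => t; rewrite mxE.
Qed.

Lemma mxintegralZ p q (c : C) (F : R -> 'M[C]_(p, q)) : mxintegrable F ->
  mxintegral (fun t => c *: F t) = c *: mxintegral F.
Proof.
move=> hF; apply/matrixP => i j; rewrite !mxE -cintegralZ //.
by congr cintegral; apply/funext => t; rewrite mxE.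
Qed.

Lemma mxintegral_mull p q r (A : 'M[C]_(p, q)) (F : R -> 'M[C]_(q, r)) : mxintegrable F ->
  mxintegral (fun t => A *m F t) = A *m mxintegral F.
Proof.
move=> hF; apply/matrixP => i j; rewrite !mxE.
under [RHS]eq_bigr do rewrite mxE -cintegralZ //.
rewrite -cintegral_sum => [|k]; last exact: cintegrableZ.
by congr cintegral; apply/funext => t; rewrite mxE.
Qed.

Lemma mxintegral_mulr p q r (A : 'M[C]_(q, r)) (F : R -> 'M[C]_(p, q)) : mxintegrable F ->
  mxintegral (fun t => F t *m A) = mxintegral F *m A.
Proof.
move=> hF; apply/matrixP => i j; rewrite !mxE.
under [RHS]eq_bigr do rewrite mxE mulrC -cintegralZ //.
rewrite -cintegral_sum => [|k]; last exact: cintegrableZ.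
congr cintegral; apply/funext => t; rewrite mxE.
by apply: eq_bigr => k _; rewrite mulrC.
Qed.

Lemma mxintegral_adj p q (F : R -> 'M[C]_(p, q)) : mxintegrable F ->
  (mxintegral F)^t* = mxintegral (fun t => (F t)^t*).
Proof.
move=> hF; apply/matrixP => i j; rewrite !mxE -[RHS]/(cintegral _).
transitivity ((cintegral (fun t => F t j i))^*); first by [].
by rewrite -cintegral_conj //; congr cintegral; apply/funext => t; rewrite !mxE.
Qed.

Lemma eq_mxintegral p q (F G : R -> 'M[C]_(p, q)) : F =1 G -> mxintegral F = mxintegral G.
Proof. by move=> /funext ->. Qed.

End MatrixIntegral.

(* Locked, since unfolding it makes unification compare Lebesgue integrals. *)
HB.lock Definition wI (R : realType) (N : nat) (w : R -> 'M[R]_N.+1) (r : R -> R[i])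
    (A B : {poly 'M[R[i]]_N.+1}) : 'M[R[i]]_N.+1 :=
  mxintegral (fun t => r t *: (mpeval A t%:C *m Wc w t *m (mpeval B t%:C)^t*)).

Section WeightedIntegral.
Context (R : realType) (N : nat).
Local Notation C := R[i].
Local Notation mpoly := {poly 'M[C]_N.+1}.
Implicit Types (A B K : mpoly) (r : R -> C) (z : C) (w : R -> 'M[R]_N.+1).

Lemma wIE w r A B :
  wI w r A B = mxintegral (fun t => r t *: (mpeval A t%:C *m Wc w t *m (mpeval B t%:C)^t*)).
Proof. by rewrite wI.unlock. Qed.

Definition moments w : Prop := forall i j, finite_moments (fun t => w t i j).

Lemma mxinnerE w A B : mxinner w A B = wI w (fun=> 1) A B.
Proof. by rewrite wIE; apply: eq_mxintegral => t; rewrite scale1r. Qed.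

Lemma tame_mpeval A i j : tame (fun t => mpeval A t%:C i j).
Proof.
apply: (@eq_tame _ (fun t => \sum_(k < size A) t%:C ^+ k * A`_k i j)).
  by move=> t; rewrite (mpevalE _ (leqnn _)) summxE; apply: eq_bigr => k _; rewrite mxE.
apply: tame_sum => k; apply: tameM (tame_cst _).
by apply: tameX; exact: tame_id.
Qed.

Lemma wI_integrand w r A B i j t :
  (r t *: (mpeval A t%:C *m Wc w t *m (mpeval B t%:C)^t*)) i j =
  \sum_b \sum_a (r t * (mpeval A t%:C i a * (mpeval B t%:C j b)^*)) * (w t a b)%:C.
Proof.
rewrite !mxE mulr_sumr; apply: eq_bigr => b _; rewrite !mxE mulr_suml mulr_sumr.
by apply: eq_bigr => a _; rewrite !mxE /=; ring.
Qed.

Lemma tame_wI_factor r A B i j a b : tame r ->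
  tame (fun t => r t * (mpeval A t%:C i a * (mpeval B t%:C j b)^*)).
Proof.
move=> hr; apply: tameM hr _; apply: tameM (tame_mpeval _ _ _) _.
exact: tame_conj (tame_mpeval _ _ _).
Qed.

Lemma wI_integrable w r A B : moments w -> tame r ->
  mxintegrable (fun t => r t *: (mpeval A t%:C *m Wc w t *m (mpeval B t%:C)^t*)).
Proof.
move=> hw hr i j; apply: eq_cintegrable (fun t => esym (wI_integrand w r A B i j t)) _.
apply: cintegrable_sum => b; apply: cintegrable_sum => a.
by apply: tame_integrable => //; exact: tame_wI_factor.
Qed.

Lemma wI_entry w r A B i j : moments w -> tame r ->
  wI w r A B i j = \sum_b \sum_a cintegral
    (fun t => (r t * (mpeval A t%:C i a * (mpeval B t%:C j b)^*)) * (w t a b)%:C).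
Proof.
move=> hw hr.
have hi a b : cintegrable
    (fun t => (r t * (mpeval A t%:C i a * (mpeval B t%:C j b)^*)) * (w t a b)%:C).
  by apply: tame_integrable => //; exact: tame_wI_factor.
rewrite wIE mxE; under eq_fun do rewrite wI_integrand.
rewrite cintegral_sum => [|b]; last exact: cintegrable_sum.
by apply: eq_bigr => b _; rewrite cintegral_sum.
Qed.

Lemma conjc_subr (t : R) z : conjc (t%:C - z) = t%:C - conjc z.
Proof. by case: z => a b /=; congr (_ +i* _); ring. Qed.

(** Substitute [A(t) = A(z) + (t - z) dq A z (t)]. When [r] is a resolvent at [z] the factor [t - z]
    cancels, which separates a Cauchy transform from a polynomial remainder. *)
Lemma wI_dql w r A B z : moments w -> tame r ->
  wI w r A B = mpeval A z *m wI w r 1 B + wI w (fun t => r t * (t%:C - z)) (dq A z) B.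
Proof.
move=> hw hr; have hr' : tame (fun t => r t * (t%:C - z)).
  by apply: tameM hr _; exact: tameD (@tame_id R) (tame_cst _).
rewrite !wIE -mxintegral_mull; last exact: wI_integrable.
rewrite -mxintegralD; last exact: wI_integrable.
  apply: eq_mxintegral => t; rewrite {1}(mpeval_dq A z t%:C) !mulmxDl scalerDr.
  by rewrite -!scalemxAl scalerA mpevalC mul1mx -scalemxAr !mulmxA.
move=> i j.
have := @wI_integrable w r ((mpeval A z)%:P) B hw hr i j.
apply: eq_cintegrable => t; rewrite !mpevalC.
by rewrite mul1mx -scalemxAr !mulmxA.
Qed.

(** The mirror image of [wI_dql]; the node is the conjugate of [z] because [B] enters through its
    adjoint. *)
Lemma wI_dqr w r A B z : moments w -> tame r ->
  wI w r A B = wI w r A 1 *m (mpeval B z^*)^t* + wI w (fun t => r t * (t%:C - z)) A (dq B z^*).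
Proof.
move=> hw hr; have hr' : tame (fun t => r t * (t%:C - z)).
  by apply: tameM hr _; exact: tameD (@tame_id R) (tame_cst _).
rewrite !wIE -mxintegral_mulr; last exact: wI_integrable.
rewrite -mxintegralD; last exact: wI_integrable.
  apply: eq_mxintegral => t; rewrite {1}(mpeval_dq B z^* t%:C) trmxCD trmxCZ.
  rewrite !mulmxDr scalerDr mpevalC trmx1 map_mx1 mulmx1 -scalemxAl -scalemxAr scalerA.
  by rewrite conjc_subr conjcK.
move=> i j.
have := @wI_integrable w r A ((mpeval B z^*)%:P) hw hr i j.
apply: eq_cintegrable => t; rewrite !mpevalC.
by rewrite trmx1 map_mx1 mulmx1 -scalemxAl.
Qed.

Lemma wI_adj w r A B : (forall t, (w t)^T = w t) -> moments w -> tame r ->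
  (wI w r A B)^t* = wI w (fun t => (r t)^*) B A.
Proof.
move=> sw hw hr; rewrite !wIE mxintegral_adj; last exact: wI_integrable.
apply: eq_mxintegral => t; rewrite trmxCZ !trmxCM trmxCK mulmxA.
suff -> : (Wc w t)^t* = Wc w t by [].
by apply/matrixP => i j; rewrite !mxE -[in RHS]sw mxE; exact: conjc_real.
Qed.

Lemma wIDl w r A A' B : moments w -> tame r ->
  wI w r (A + A') B = wI w r A B + wI w r A' B.
Proof.
move=> hw hr; rewrite !wIE -mxintegralD; try exact: wI_integrable.
by apply: eq_mxintegral => t; rewrite mpevalD !mulmxDl scalerDr.
Qed.

(** The two terms of the equation for [w'] are absorbed by [A] on the left and by the adjoint of [B]
    on the right. *)
Lemma wI_pearson w w' r A B K eps : moments w -> moments w' -> tame r ->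
  (forall t, eps *: Wc w' t = mpeval K t%:C *m Wc w t + Wc w t *m (mpeval K t%:C)^t*) ->
  eps *: wI w' r A B = wI w r (A * K) B + wI w r A (B * K).
Proof.
move=> hw hw' hr hK; rewrite !wIE -mxintegralD; try exact: wI_integrable.
rewrite -mxintegralZ; last exact: wI_integrable.
apply: eq_mxintegral => t; rewrite scalerA mulrC -scalerA -scalerDr; congr (_ *: _).
rewrite -[X in X *m _]/(_ *m _) scalemxAl scalemxAr hK !mpevalM trmxCM.
by rewrite mulmxDr mulmxDl !mulmxA.
Qed.

(** Entrywise integration by parts; the squared resolvent is minus the derivative of the
    resolvent. *)
Lemma wI_parts w w' z A B : complex.Im z != 0 -> moments w -> moments w' ->
  (forall i j t, is_derive (t : R^o) (1 : R^o) ((fun s => w s i j) : R^o -> R^o) (w' t i j)) ->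
  (forall i j, continuous (fun t => w' t i j)) ->
  let r t := (t%:C - z)^-1 in
  wI w' r A B = wI w (fun t => r t ^+ 2) A B - wI w r A^`() B - wI w r A B^`().
Proof.
move=> z0 hw hw' dw cw' r.
have hr : tame r by exact: tame_resolvent.
have hr2 : tame (fun t => r t ^+ 2) by exact: tameX.
apply/matrixP => i j.
have mxB3 (M1 M2 M3 : 'M[C]_N.+1) : (M1 - M2 - M3) i j = M1 i j - M2 i j - M3 i j.
  by rewrite !mxE.
apply: etrans (esym (mxB3 _ _ _)).
rewrite (wI_entry A B i j hw' hr) (wI_entry A B i j hw hr2).
rewrite (wI_entry A^`() B i j hw hr) (wI_entry A B^`() i j hw hr).
rewrite -!sumrN -!big_split /=; apply: eq_bigr => b _.
rewrite -!sumrN -!big_split /=; apply: eq_bigr => a _.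
(* The extension of the scalar integrand off the line. Conjugating both the argument and the value
   of the [B] factor makes it complex differentiable away from [z]. *)
pose rho A B zeta := (zeta - z)^-1 * (mpeval A zeta i a * (mpeval B zeta^* j b)^*).
have mB B' zeta : cder (fun x => (mpeval B' x^* j b)^*) zeta (mpeval B'^`() zeta^* j b)^*.
  exact: cder_conj (mpeval_derive B' zeta^* j b).
have drho A' B' zeta : zeta - z != 0 -> cder (rho A' B') zeta
    (- ((zeta - z)^-1 ^+ 2 * (mpeval A' zeta i a * (mpeval B' zeta^* j b)^*)) +
     (rho A'^`() B' zeta + rho A' B'^`() zeta)).
  move=> zz; apply: cder_ext (cderM (cder_resolvent zz)
    (cderM (mpeval_derive A' zeta i a) (mB B' zeta))) => //.
  by rewrite mulrDr mulNr.
have cR (t : R) : t%:C^* = t%:C by exact: conjc_real.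
pose rho' zeta := - ((zeta - z)^-1 ^+ 2 * (mpeval A zeta i a * (mpeval B zeta^* j b)^*)) +
     (rho A^`() B zeta + rho A B^`() zeta).
have trho A' B' : tame (fun t => rho A' B' t%:C).
  by apply: eq_tame (tame_wI_factor A' B' i j a b hr) => t; rewrite /rho cR.
have trho2 A' B' : tame (fun t => r t ^+ 2 * (mpeval A' t%:C i a * (mpeval B' t%:C j b)^*)).
  exact: tame_wI_factor.
have trho' : tame (fun t => rho' t%:C).
  apply: tameD; last exact: tameD.
  apply: eq_tame (tameM (tame_cst (-1)) (trho2 A B)) => t.
  by rewrite cR mulN1r.
have := @cintegral_parts R (rho A B) rho' (fun t => w t a b) (fun t => w' t a b).
move=> /(_ _ _ (trho A B) trho' (dw a b) (cw' a b) (hw a b) (hw' a b)) H.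
transitivity (cintegral (fun t => rho A B t%:C * (w' t a b)%:C)).
  by congr cintegral; apply/funext => t; rewrite /rho cR.
rewrite H.
- pose f A' B' s t := s t * (mpeval A' t%:C i a * (mpeval B' t%:C j b)^*) * (w t a b)%:C.
  have int A' B' s : tame s -> cintegrable (f A' B' s).
    by move=> hs; apply: tame_integrable => //; exact: tame_wI_factor.
  have -> : (fun t => rho' t%:C * (w t a b)%:C) =
      (fun t => - 1 * f A B (fun t => r t ^+ 2) t + (f A^`() B r t + f A B^`() r t)).
    have alg (u a1 b1 a2 b2 v : C) : (- (u ^+ 2 * (a1 * b1)) + (u * (a2 * b1) + u * (a1 * b2))) * v =
      - 1 * (u ^+ 2 * (a1 * b1) * v) + (u * (a2 * b1) * v + u * (a1 * b2) * v) by ring.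
    by apply/funext => t; rewrite /rho' /rho /f /r cR alg.
  rewrite cintegralD ?cintegralD ?cintegralZ //; try exact: int.
  + by rewrite mulN1r opprD opprK opprD addrA.
  + by apply: cintegrableZ; exact: int.
  + by apply: cintegrableD; exact: int.
- by move=> t; apply: drho; exact: subc_neq0.
- move=> t; have zz := subc_neq0 t z0; eexists.
  apply: cderD; last by apply: cderD; exact: drho.
  apply: cder_ext (cderM (cder_cst (-1) _) (cderM (cderM (cder_resolvent zz) (cder_resolvent zz))
    (cderM (mpeval_derive A _ i a) (mB B _)))) => // x.
  by rewrite mulN1r expr2.
Qed.

(** The moments of [A W]; for [A = P n] they are the [b_{n,k}], see [bcoefE]. *)
Definition mom w A k : 'M[C]_N.+1 := wI w (fun t => t%:C ^+ k) A 1.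

Lemma mom_integral w A k :
  mom w A k = mxintegral (fun x => x%:C ^+ k *: (mpeval A x%:C *m Wc w x)).
Proof.
by rewrite /mom wIE; apply: eq_mxintegral => t; rewrite mpevalC trmx1 map_mx1 mulmx1.
Qed.

(** The scalar [t ^ k] is real, so it may be moved into the adjoint factor; vanishing moments thus
    become orthogonality to monomials. *)
Lemma momE w A k : mom w A k = wI w (fun=> 1) A 'X^k.
Proof.
rewrite mom_integral wIE; apply: eq_mxintegral => t; rewrite scale1r.
have -> : mpeval 'X^k t%:C = (t%:C ^+ k)%:M :> 'M[C]_N.+1.
  by rewrite /mpeval hornerXn rmorphXn.
rewrite tr_scalar_mx map_scalar_mx mul_mx_scalar; congr (_ *: _).
by rewrite -rmorphXn; exact/esym/conjc_real.
Qed.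

Lemma wI_mom w A B n : moments w -> (size B <= n)%N ->
  wI w (fun=> 1) A B = \sum_(k < n) mom w A k *m (B`_k)^t*.
Proof.
move=> hw sB.
have ti k : tame (fun t => (t%:C : C) ^+ k) by apply: tameX; exact: tame_id.
have im k : mxintegrable (fun t => t%:C ^+ k *: (mpeval A t%:C *m Wc w t) *m (B`_k)^t*).
  move=> i j; have := @wI_integrable w _ A (B`_k)%:P hw (ti k) i j.
  by apply: eq_cintegrable => t; rewrite mpevalC -scalemxAl.
transitivity (\sum_(k < n) mxintegral (fun t => t%:C ^+ k *: (mpeval A t%:C *m Wc w t) *m (B`_k)^t*)).
  rewrite wIE; apply/matrixP => i j; rewrite [LHS]mxE [RHS]summxE.
  under [RHS]eq_bigr do rewrite mxE.
  rewrite -cintegral_sum => [|k]; last exact: im.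
  congr cintegral; apply/funext => t.
  rewrite scale1r (mpevalE _ sB) trmxC_sum mulmx_sumr summxE; apply: eq_bigr => k _.
  rewrite trmxCZ rmorphXn /= oppr0 -scalemxAl -scalemxAr.
  by rewrite !mxE.
apply: eq_bigr => k _; rewrite mom_integral mxintegral_mulr // => i j.
have := @wI_integrable w _ A 1 hw (ti k) i j.
by apply: eq_cintegrable => t; rewrite mpevalC trmx1 map_mx1 mulmx1.
Qed.

End WeightedIntegral.

(** * Orthogonality *)

Section Orthogonality.
Context (R : realType) (N : nat).
Local Notation C := R[i].
Local Notation mpoly := {poly 'M[C]_N.+1}.
Local Notation mu := (@lebesgue_measure R).
Context (W : R -> 'M[R]_N.+1) (hW : weight W).
Implicit Types (A B K Q : mpoly) (z : C).

Definition dweight (t : R) : 'M[R]_N.+1 := \matrix_(i, j) derive1 (fun x => W x i j) t.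

Lemma weight_sym t : (W t)^T = W t.
Proof. by have [_ /(_ t)[]] := hW. Qed.

Lemma weight_moments : moments W.
Proof. by move=> i j; have [_ _ /(_ i j)[]] := hW. Qed.

Lemma dweight_moments : moments dweight.
Proof.
move=> i j; have [_ _ /(_ i j)[_]] := hW.
by congr finite_moments; apply/funext => t; rewrite mxE.
Qed.

Lemma is_derive_weight i j t :
  is_derive (t : R^o) (1 : R^o) ((fun s => W s i j) : R^o -> R^o) (dweight t i j).
Proof.
have [/(_ i j 0%N t) dW _ _] := hW.
by rewrite mxE derive1E; apply: DeriveDef.
Qed.

Lemma dweight_continuous i j : continuous (fun t => dweight t i j).
Proof.
have [/(_ i j 1%N) dW _ _] := hW.
have -> : (fun t => dweight t i j) = derive1 (fun x => W x i j) by apply/funext => t; rewrite mxE.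
by move=> t; apply: differentiable_continuous; apply/derivable1_diffP; exact: dW.
Qed.

Lemma tame1 : tame (fun=> 1 : C).
Proof. exact: tame_cst. Qed.

Local Notation ip := (wI W (fun=> 1)).

Lemma ip_adj A B : (ip A B)^t* = ip B A.
Proof.
rewrite wI_adj //; first by under [X in wI _ X]eq_fun do rewrite rmorph1.
- exact: weight_sym.
- exact: weight_moments.
- exact: tame1.
Qed.

Lemma ipDl A A' B : ip (A + A') B = ip A B + ip A' B.
Proof. by rewrite wIDl //; [exact: weight_moments|exact: tame1]. Qed.

Lemma ipCl (c : 'M[C]_N.+1) A B : ip (c%:P * A) B = c *m ip A B.
Proof.
rewrite !wIE -mxintegral_mull; last first.
  by apply: wI_integrable; [exact: weight_moments|exact: tame1].
by apply: eq_mxintegral => t; rewrite !scale1r mpevalM mpevalC !mulmxA.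
Qed.

Context (P : nat -> mpoly) (hP : monic_orthogonal W P).

Lemma size_P n : size (P n) = n.+1.
Proof. by have [] := hP n. Qed.

Lemma coef_Pn n : (P n)`_n = 1.
Proof. by have [/monicP + sP _] := hP n; rewrite lead_coefE sP. Qed.

Lemma orthr n Q : (size Q <= n)%N -> ip (P n) Q = 0.
Proof. by move=> sQ; rewrite -mxinnerE; have [_ _] := hP n; apply. Qed.

Lemma orthl n Q : (size Q <= n)%N -> ip Q (P n) = 0.
Proof. by move=> sQ; rewrite -ip_adj orthr // trmx0 map_mx0. Qed.

Definition gram n := ip (P n) (P n).

(** Subtracting [Q_n P_n] from [Q] leaves degree less than [n], which is orthogonal to [P n]. *)
Lemma ip_lead n Q : (size Q <= n.+1)%N -> ip Q (P n) = Q`_n *m gram n.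
Proof.
move=> sQ; pose Q' := Q + (- Q`_n)%:P * P n.
have sQ' : (size Q' <= n)%N.
  apply/leq_sizeP => j; rewrite leq_eqVlt => /orP[/eqP <-|nj].
    by rewrite coefD coefCM coef_Pn mulr1 subrr.
  rewrite coefD coefCM (nth_default 0 (leq_trans sQ nj)).
  by rewrite (@nth_default _ 0 (P n) j) ?size_P // mulr0 addr0.
have := orthl sQ'; rewrite ipDl ipCl mulNmx => /eqP.
by rewrite subr_eq0 => /eqP.
Qed.

Lemma dq_PSn n z : (dq (P n.+1) z)`_n = 1.
Proof.
by rewrite coef_dq mpeval_drop coef_Pn drop_poly_eq0 ?size_P // mpeval0 scaler0 addr0.
Qed.

Lemma gram_adj n : (gram n)^t* = gram n.
Proof. exact: ip_adj. Qed.

(** The cross terms between real and imaginary parts cancel because [W t] is symmetric. This brings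
    complex vectors under the positivity assumed for real ones. *)
Lemma quad_real (t : R) (u : 'rV[C]_N.+1) :
  (u *m Wc W t *m u^t*) 0 0 =
  ((map_mx (@complex.Re R) u *m W t *m (map_mx (@complex.Re R) u)^T) 0 0 +
   (map_mx (@complex.Im R) u *m W t *m (map_mx (@complex.Im R) u)^T) 0 0)%:C.
Proof.
set x := map_mx (@complex.Re R) u; set y := map_mx (@complex.Im R) u.
have eu : u = map_mx (real_complex R) x + 'i *: map_mx (real_complex R) y.
  by apply/matrixP => i j; rewrite !mxE -complexE.
have eu' : u^t* = map_mx (real_complex R) x^T - 'i *: map_mx (real_complex R) y^T.
  apply/matrixP => i j; rewrite !mxE; case: (u j i) => a b /=.
  by congr (_ +i* _); ring.
have yx : (y *m W t *m x^T) 0 0 = (x *m W t *m y^T) 0 0.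
  have -> : x *m W t *m y^T = (y *m W t *m x^T)^T by rewrite !trmx_mul trmxK weight_sym mulmxA.
  by rewrite [RHS]mxE.
have -> : u *m Wc W t *m u^t* =
    map_mx (real_complex R) (x *m W t *m x^T) + map_mx (real_complex R) (y *m W t *m y^T) +
    'i *: (map_mx (real_complex R) (y *m W t *m x^T) - map_mx (real_complex R) (x *m W t *m y^T)).
  rewrite eu' {1}eu /Wc !map_mxM mulmxBr !mulmxDl -!scalemxAl -!scalemxAr.
  set a := map_mx _ x *m _ *m map_mx _ x^T; set b := map_mx _ y *m _ *m map_mx _ y^T.
  set c := map_mx _ x *m _ *m map_mx _ y^T; set d := map_mx _ y *m _ *m map_mx _ x^T.
  have i2 : 'i * 'i = -1 :> C by congr (_ +i* _); ring.
  rewrite scalerA i2 scaleN1r scalerBr opprD opprK -!addrA; congr (_ + _).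
  by rewrite [in LHS]addrA [in LHS]addrC.
have E4 (M1 M2 M3 M4 : 'M[R]_1) : (map_mx (real_complex R) M1 + map_mx (real_complex R) M2 +
    'i *: (map_mx (real_complex R) M3 - map_mx (real_complex R) M4)) 0 0 =
    (M1 0 0 + M2 0 0)%:C + 'i * (M3 0 0 - M4 0 0)%:C.
  by rewrite !mxE rmorphD rmorphB.
by rewrite E4 yx subrr mulr0 addr0.
Qed.

Lemma posdef_quad t (v : 'rV[R]_N.+1) : 0 <= (v *m W t *m v^T) 0 0 ?= iff (v == 0).
Proof.
have [_ /(_ t)[_ H] _] := hW; have [->|v0] := eqVneq v 0.
  by rewrite !mul0mx mxE; exact/leif_refl.
by apply/leifP; exact: H.
Qed.

(** If [v] kills the Gram matrix, the nonnegative function [phi], the quadratic form of [W] at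
    [v P_n], has integral 0 and so vanishes almost everywhere. Each zero of [phi] is a root of one
    fixed nonzero polynomial, and an interval beyond all real roots gives a contradiction. *)
Lemma gram_unit n : gram n \in unitmx.
Proof.
rewrite unitmxE unitfE; apply/det0P => -[v v0 vG].
have [j vj] : exists j, v 0 j != 0.
  apply/existsP; apply: contraNT v0 => /existsPn H; apply/eqP/rowP => k; rewrite mxE.
  by apply/eqP; have := H k; rewrite negbK.
pose u t := v *m mpeval (P n) t%:C.
pose x t := map_mx (@complex.Re R) (u t); pose y t := map_mx (@complex.Im R) (u t).
pose phi t := (x t *m W t *m (x t)^T) 0 0 + (y t *m W t *m (y t)^T) 0 0.
have phi_ge0 t : 0 <= phi t by rewrite addr_ge0 // posdef_quad.
have phiE t : (phi t)%:C = (v *m (mpeval (P n) t%:C *m Wc W t *m (mpeval (P n) t%:C)^t*) *m v^t*) 0 0.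
  by rewrite -quad_real /u trmxCM !mulmxA.
have hi : mxintegrable (fun t => mpeval (P n) t%:C *m Wc W t *m (mpeval (P n) t%:C)^t*).
  move=> i k; have := @wI_integrable _ _ W _ (P n) (P n) weight_moments tame1 i k.
  by apply: eq_cintegrable => t; rewrite scale1r.
have hiv : cintegrable (fun t => (phi t)%:C).
  apply: (@eq_cintegrable _ (fun t => \sum_k (\sum_l v 0 l *
     (mpeval (P n) t%:C *m Wc W t *m (mpeval (P n) t%:C)^t*) l k) * (v^t*) k 0)).
    by move=> t; rewrite phiE [RHS]mxE; apply: eq_bigr => k _; congr (_ * _); rewrite [RHS]mxE.
  apply: cintegrable_sum => k; apply: eq_cintegrable (fun t => mulrC _ _) _.
  by apply: cintegrableZ; apply: cintegrable_sum => l; exact: cintegrableZ.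
have phi0 : cintegral (fun t => (phi t)%:C) = 0.
  transitivity ((v *m gram n *m v^t*) 0 0); last by rewrite vG mul0mx mxE.
  have hvi : mxintegrable (fun t => v *m (mpeval (P n) t%:C *m Wc W t *m (mpeval (P n) t%:C)^t*)).
    move=> i k; apply: (@eq_cintegrable _ (fun t => \sum_l v i l *
     (mpeval (P n) t%:C *m Wc W t *m (mpeval (P n) t%:C)^t*) l k)).
      by move=> t; rewrite [RHS]mxE.
    by apply: cintegrable_sum => l; exact: cintegrableZ.
  rewrite /gram -mxinnerE /mxinner -mxintegral_mull // -mxintegral_mulr // [RHS]mxE.
  by congr cintegral; apply/funext => t; rewrite phiE.
(* The [j]-th entry of the row [v P_n]; its coefficient of degree [n] is [v_j], nonzero, because
   [P n] is monic. *)
pose p := \sum_i v 0 i *: entryp (P n) i j.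
have pn : p`_n != 0.
  rewrite coef_sum (bigD1 j) //= big1 => [|i /negbTE ij].
    by rewrite coefZ coef_poly size_P ltnSn coef_Pn mxE eqxx mulr1 addr0.
  by rewrite coefZ coef_poly size_P ltnSn coef_Pn mxE ij mulr0.
have p0 : p != 0 by apply: contraNneq pn => ->; rewrite coef0.
have pE t : p.[t%:C] = u t 0 j.
  by rewrite horner_sum mxE; apply: eq_bigr => i _; rewrite hornerZ entrypE.
have phip t : phi t = 0 -> p.[t%:C] = 0.
  move=> /eqP; rewrite paddr_eq0 ?posdef_quad // => /andP[].
  have pq0 (q : 'rV[R]_N.+1) : (q *m W t *m q^T) 0 0 == 0 -> q = 0.
    by rewrite eq_sym (posdef_quad t q) => /eqP.
  move=> /pq0 /rowP/(_ j) xj /pq0 /rowP/(_ j) yj; rewrite pE.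
  by apply/eqP; rewrite eq_complex; move: xj yj; rewrite !mxE => -> ->; rewrite !eqxx.
have [r pr] := closed_field_poly_normal p.
(* No real root of [p] exceeds [M]. *)
pose M : R := \sum_(c <- r) `|complex.Re c|.
have [hphi _] := hiv.
have /ae_eq_integral_abs : (\int[mu]_t `|(phi t)%:E| = 0)%E.
  have := congr1 (@complex.Re R) phi0; rewrite /cintegral /Rintegral /= => I0.
  have fin : (\int[mu]_t (phi t)%:E \is a fin_num)%E by exact: integrable_fin_num.
  under eq_integral do rewrite /= ger0_norm //.
  by rewrite -(fineK fin) I0.
case=> //; first exact: measurable_int hphi.
move=> A [mA A0 subA].
(* On this interval of length 1 the function [phi] has no zero, so the interval lies in the null set
   [A]. *)
have : (mu `[(M + 1)%R, (M + 2)%R]%classic <= mu A)%E.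
  apply: le_measure; rewrite ?inE //.
  move=> t; rewrite /= in_itv /= => /andP[t1 _]; apply: subA => /= H.
  have /phip : phi t = 0 by have := H I; case.
  move=> /eqP; rewrite -rootE pr rootZ ?lead_coef_eq0 // root_prod_XsubC => tr.
  have : t <= M.
    rewrite /M (big_rem _ tr) /= (le_trans (ler_norm _)) // lerDl sumr_ge0 //.
  by lra.
rewrite A0 lebesgue_measure_itv /= lte_fin.
have -> : M + 1 < M + 2 by lra.
by rewrite -EFinB lee_fin; lra.
Qed.

End Orthogonality.

(** * The coefficients of F_n in integral form *)

Section Coefficients.
Context (R : realType) (N : nat).
Local Notation C := R[i].
Local Notation mpoly := {poly 'M[C]_N.+1}.
Context (W : R -> 'M[R]_N.+1) (hW : weight W).
Context (P : nat -> mpoly) (hP : monic_orthogonal W P).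
Implicit Types (A B K Q : mpoly) (z : C).

Local Notation ip := (wI W (fun=> 1)).

Lemma gamE n : gam W P n = invmx (gram W P n).
Proof. by rewrite /gam mxinnerE. Qed.

Lemma gam_adj n : (gam W P n)^t* = gam W P n.
Proof. by rewrite gamE trmxCV gram_adj. Qed.

Lemma mom_P0 n k : (k < n)%N -> mom W (P n) k = 0.
Proof. by move=> kn; rewrite momE (orthr hP) // size_polyXn. Qed.

(** Orthogonality makes the moments below [n] vanish, in agreement with the value 0 of [bcoef]
    there. *)
Lemma bcoefE n k : bcoef W P n k = mom W (P n) k.
Proof. by rewrite /bcoef; case: leqP => kn; [rewrite mom_integral|rewrite mom_P0]. Qed.

Lemma size_PK K n : (size (P n * K)%R <= (n + (size K).-1).+1)%N.
Proof.
by apply: leq_trans (size_polyMleq _ _) _; rewrite (size_P hP); case: (size K) => [|k]; lia.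
Qed.

(** In the product formula the coefficients of [K] below [m - j] meet coefficients of [P n] beyond
    degree [n], and those above [m] are 0; [k] counts from [m - j]. *)
Lemma coef_PK K n j : (j <= (size K).-1)%N ->
  (P n * K)`_(n + (size K).-1 - j) =
  \sum_(k < j.+1 | (k <= n)%N) (P n)`_(n - k) *m K`_((size K).-1 - j + k).
Proof.
set m := (size K).-1 => jm.
have K0 s : (m < s)%N -> K`_s = 0.
  by move=> ms; rewrite nth_default //; apply: leq_trans ms; exact: leqSpred.
rewrite -addnBA // coefMr; set q := (n + (m - j))%N.
rewrite -(big_mkord xpredT (fun s => (P n)`_(q - s) * K`_s)).
rewrite (@big_cat_nat _ _ _ (m - j)) //=; last by rewrite ltnW // ltnS leq_addl.
rewrite big_nat_cond big1 ?add0r => [|s /andP[/andP[_ sm] _]]; last first.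
  suff -> : (P n)`_(q - s) = 0 by exact: mul0r.
  by apply: nth_default; rewrite (size_P hP) /q; lia.
rewrite -{1}[(m - j)%N]add0n big_addn.
have -> : (q.+1 - (m - j) = n.+1)%N by rewrite /q -addSn addnK.
rewrite (big_nat_widen _ _ (n.+1 + j.+1)) ?leq_addr //.
rewrite -(big_mkord (fun k => (k <= n)%N) (fun k => (P n)`_(n - k) *m K`_(m - j + k))).
rewrite [RHS](big_nat_widen _ _ (n.+1 + j.+1)) ?leq_addl //.
rewrite big_mkcond [RHS]big_mkcond /=; apply: eq_bigr => k _.
rewrite ltnS /q subnDr [(k + (m - j))%N]addnC; case: (leqP k n) => //= kn.
rewrite ltnS; case: (leqP k j) => //= jk.
by rewrite K0 ?mulr0 // -{1}(subnK jm) ltn_add2l.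
Qed.

Lemma Pk0 n z : Pk P n 0 z = (P n)`_n.
Proof. by rewrite /Pk big_mkcond big_ord_recl big_ord0 /= !subn0 expr0 scale1r addr0. Qed.

Lemma PkS n k z :
  Pk P n k.+1 z = z *: Pk P n k z + (if (k < n)%N then (P n)`_(n - k.+1) else 0).
Proof.
rewrite {1}/Pk big_mkcond big_ord_recr /= subnn expr0 scale1r; congr (_ + _).
rewrite /Pk [in RHS]big_mkcond scaler_sumr; apply: eq_bigr => l _.
case: ifP => _; last by rewrite scaler0.
by rewrite scalerA -exprS subSn // -ltnS.
Qed.

(** Induction on [j]: [Delta] obeys the Horner recursion [mpeval_drop]. Hence the values of [Delta]
    are coefficients of the difference quotient of [P n * K]. *)
Lemma DeltaE K j n z : (j <= (size K).-1)%N ->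
  Delta P K j n z = mpeval (drop_poly (n + (size K).-1 - j) (P n * K)) z.
Proof.
set m := (size K).-1; elim: j => [|j IH] jm.
  rewrite mpeval_drop coef_PK // -/m [X in _ + _ *: X](_ : _ = 0); last first.
    by rewrite drop_poly_eq0 ?mpeval0 // subn0 size_PK.
  by rewrite scaler0 addr0 /Delta big_ord_recl big_ord0 [in RHS]big_mkcond
    [in RHS]big_ord_recl big_ord0 /= Pk0 !subn0.
rewrite mpeval_drop coef_PK // -/m.
have -> : (n + m - j.+1).+1 = (n + m - j)%N by rewrite subnSK // ltn_addl.
rewrite -IH 1?ltnW // /Delta -/m [LHS]big_ord_recl Pk0 addn0.
rewrite [X in _ = X + _]big_mkcond [X in _ = X + _]big_ord_recl /= subn0 addn0 -addrA.
congr (_ + _); rewrite scaler_sumr -big_split /=; apply: eq_bigr => k _.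
rewrite /bump /= add1n.
have -> : (m - j.+1 + k.+1 = m - j + k)%N by lia.
rewrite PkS mulmxDl -scalemxAl addrC; congr (_ + _).
by case: ifP => _ //; rewrite mul0mx.
Qed.

(** The integral [E(A, B)] of the overview, with its difference quotients as polynomials; the second
    is taken at the conjugate node because [B] enters through its adjoint. *)
Definition Emx K z A B : 'M[C]_N.+1 :=
  ip (dq (A * K) z) B + ip A (dq (B * K) z^*).

Lemma Emx_adj K z A B : (Emx K z^* A B)^t* = Emx K z B A.
Proof. by rewrite /Emx trmxCD !ip_adj // conjcK addrC. Qed.

(** Expanding in moments of [A], the first [n] terms drop out and the degree bound on [Q] leaves [m]
    of them. *)
Lemma ip_dq_tail A Q n m z : (forall k, (k < n)%N -> mom W A k = 0) ->
  (size Q <= (n + m).+1)%N ->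
  ip A (dq Q z) = \sum_(i < m) mom W A (n + i) *m (mpeval (drop_poly (n + i).+1 Q) z)^t*.
Proof.
move=> A0 sQ; rewrite (@wI_mom _ _ _ _ _ (n + m) (weight_moments hW)); last first.
  by apply: leq_trans (size_dq _ _) _; case: (size Q) sQ.
rewrite big_split_ord /= big1 ?add0r => [|i _]; last by rewrite A0 ?mul0mx.
by apply: eq_bigr => i _; rewrite coef_dq.
Qed.

(** Both sums of [calA] are tails from [ip_dq_tail] read backwards, with [Delta] giving the
    coefficients of the difference quotients. *)
Lemma calAE K n z : calA W P K n z = - gam W P n *m Emx K z (P n) (P n).
Proof.
rewrite /calA /Emx; congr (_ *m _); set m := (size K).-1.
rewrite big_split /= addrC; congr (_ + _).
  rewrite -ip_adj // (@ip_dq_tail _ _ n m) ?size_PK //; last exact: mom_P0.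
  rewrite trmxC_sum (reindex_inj rev_ord_inj) /=; apply: eq_bigr => i _.
  rewrite trmxCM trmxCK bcoefE DeltaE -/m; last by have := ltn_ord i; lia.
  have im := ltn_ord i.
  by congr (mpeval (drop_poly _ _) _ *m (mom _ _ _)^t*); lia.
rewrite (@ip_dq_tail _ _ n m) ?size_PK //; last exact: mom_P0.
rewrite (reindex_inj rev_ord_inj) /=; apply: eq_bigr => i _.
rewrite bcoefE /adjf DeltaE -/m; last by have := ltn_ord i; lia.
have im := ltn_ord i.
by congr (mom _ _ _ *m (mpeval (drop_poly _ _) _)^t*); lia.
Qed.

Lemma calBE K n z : calB W P K n.+1 z = - Emx K z (P n.+1) (P n) *m gam W P n.
Proof.
rewrite /calB /Emx; congr (- _ *m _); set m := (size K).-1.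
rewrite big_split /=; congr (_ + _).
  (* Counted from [n], the degree of [P n.+1 * K] allows [m + 1] terms. *)
  rewrite -ip_adj // (@ip_dq_tail _ _ n m.+1); [|exact: mom_P0|]; last first.
    by have := size_PK K n.+1; rewrite -/m addnS addSn.
  rewrite trmxC_sum (reindex_inj rev_ord_inj) /=; apply: eq_bigr => i _.
  rewrite trmxCM trmxCK bcoefE DeltaE -/m; last by have := ltn_ord i; lia.
  have im := ltn_ord i.
  by congr (mpeval (drop_poly _ _) _ *m (mom _ _ _)^t*); lia.
rewrite (@ip_dq_tail _ _ n m) ?size_PK //; last by move=> k kn; rewrite mom_P0 // ltnW.
(* Reversed, the sum in [calB] has one term more than the tail: its first, with the moment of
   [P n.+1] of index [n - 1], truncated to 0 when [n = 0]. Orthogonality makes it vanish. *)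
rewrite (reindex_inj rev_ord_inj) /= big_ord_recl /= bcoefE mom_P0 ?mul0mx ?add0r; last by lia.
apply: eq_bigr => i _.
rewrite bcoefE /adjf DeltaE -/m /bump /=; last by lia.
have im := ltn_ord i.
by congr (mom _ _ _ *m (mpeval (drop_poly _ _) _)^t*); lia.
Qed.

End Coefficients.

(** * Ladder relations *)

Section Ladder.
Context (R : realType) (N : nat).
Local Notation C := R[i].
Local Notation mpoly := {poly 'M[C]_N.+1}.
Context (W : R -> 'M[R]_N.+1) (hW : weight W).
Context (P : nat -> mpoly) (hP : monic_orthogonal W P).
Context (K : mpoly) (eps : C).
(* Used with [eps = 1], [K = G] and with [eps = 0], [K = H]. *)
Hypothesis pearson : forall t : R, eps *: Wc (dweight W) t =
  mpeval K t%:C *m Wc W t + Wc W t *m (mpeval K t%:C)^t*.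
Context (z : C) (z0 : complex.Im z != 0).
Implicit Types (A B Q : mpoly).
Local Notation r := (fun t : R => (t%:C - z)^-1).
Local Notation ip := (wI W (fun=> 1)).
Local Notation cl := (fun A => wI W r A 1).
Local Notation cr := (fun B => wI W r 1 B).
Local Notation c2 := (fun A => wI W (fun t => (t%:C - z)^-1 ^+ 2) A 1).
Local Notation "B ^@" := (adjf (mpeval B) z) (at level 2, format "B ^@").

(** In [wI_dql] the factor [t - z] cancels the resolvent, so the remainder is a plain inner product,
    open to orthogonality. *)
Lemma wI_resolventl A B : wI W r A B = mpeval A z *m cr B + ip (dq A z) B.
Proof.
rewrite (wI_dql A B z (weight_moments hW) (tame_resolvent z0)).
by under [X in wI _ X (dq _ _)]eq_fun do rewrite mulVf ?subc_neq0 //.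
Qed.

Lemma wI_resolventr A B : wI W r A B = cl A *m B^@ + ip A (dq B z^*).
Proof.
rewrite (wI_dqr A B z (weight_moments hW) (tame_resolvent z0)).
by under [X in wI _ X _ (dq _ _)]eq_fun do rewrite mulVf ?subc_neq0 //.
Qed.

Lemma wI_resolvent2r A B :
  wI W (fun t => (t%:C - z)^-1 ^+ 2) A B = c2 A *m B^@ + wI W r A (dq B z^*).
Proof.
rewrite (wI_dqr A B z (weight_moments hW) (tameX 2 (tame_resolvent z0))).
by under [X in wI _ X _ (dq _ _)]eq_fun do rewrite expr2 -mulrA mulVf ?subc_neq0 // mulr1.
Qed.

Lemma size_dq_P n w : (size (dq (P n) w) <= n)%N.
Proof. by apply: leq_trans (size_dq _ _) _; rewrite (size_P hP). Qed.

Lemma size_deriv_P n : (size (P n)^`() <= n)%N.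
Proof.
rewrite -ltnS -(size_P hP n); apply: lt_size_deriv.
by rewrite -size_poly_gt0 (size_P hP).
Qed.

Lemma size_dq_leq Q w n : (size Q <= n)%N -> (size (dq Q w) <= n.-1)%N.
Proof. by move=> sQ; apply: leq_trans (size_dq _ _) _; lia. Qed.

(** The difference quotients are traded for resolvent integrals. Their sum is [eps] times an
    integral against the derivative of [W], by [wI_pearson], and is then integrated by parts. The
    two bounds on [a] and [b] are what orthogonality needs to remove the remainders. *)
Lemma EmxE a b : (a <= b.+1)%N -> (b <= a.+1)%N ->
  Emx W K z (P a) (P b) =
  (eps *: c2 (P a) - cl (P a) *m K^@) *m (P b)^@ -
  (eps *: mpeval (P a)^`() z + mpeval (P a) z *m mpeval K z) *m cr (P b).
Proof.
move=> ab ba.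
have mW := weight_moments hW; have mdW := dweight_moments hW.
have hr := tame_resolvent z0.
have h1 : ip (dq (P a * K) z) (P b) =
    wI W r (P a * K) (P b) - mpeval (P a) z *m mpeval K z *m cr (P b).
  by rewrite wI_resolventl mpevalM addrC addKr.
have h2 : ip (P a) (dq (P b * K) z^*) =
    wI W r (P a) (P b * K) - cl (P a) *m K^@ *m (P b)^@.
  by rewrite wI_resolventr /adjf mpevalM trmxCM mulmxA addrC addKr.
have h3 := wI_pearson (P a) (P b) mW mdW hr pearson.
have h4 := wI_parts (P a) (P b) z0 mW mdW (is_derive_weight hW) (dweight_continuous (W := W) hW).
(* The difference quotient of the derivative of [P a] has size at most [a - 1 <= b], so it is
   orthogonal to [P b]. *)
have h5 : wI W r (P a)^`() (P b) = mpeval (P a)^`() z *m cr (P b).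
  rewrite wI_resolventl (orthl hW hP) ?addr0 //.
  apply: leq_trans (size_dq_leq _ (size_deriv_P a)) _; lia.
have h6 : wI W r (P a) (P b)^`() = cl (P a) *m ((P b)^`())^@.
  rewrite wI_resolventr (orthr hP) ?addr0 //.
  apply: leq_trans (size_dq_leq _ (size_deriv_P b)) _; lia.
(* Two expansions: the first leaves a simple resolvent, the second an iterated difference quotient
   orthogonal to [P a]. At its own node [dq (P b)] is the derivative of [P b]. *)
have h7 : wI W (fun t => (t%:C - z)^-1 ^+ 2) (P a) (P b) =
    c2 (P a) *m (P b)^@ + cl (P a) *m ((P b)^`())^@.
  rewrite wI_resolvent2r wI_resolventr (orthr hP) ?addr0.
    by rewrite {2}/adjf mpeval_dq_diag.
  apply: leq_trans (size_dq_leq _ (size_dq_P b _)) _; lia.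
rewrite /Emx h1 h2 addrACA -h3 h4 h5 h6 h7.
rewrite [X in eps *: X](_ : _ = c2 (P a) *m (P b)^@ - mpeval (P a)^`() z *m cr (P b)); last first.
  by rewrite addrAC addrK.
rewrite !mulmxDl !mulNmx scalerBr -!scalemxAl opprD.
by rewrite -!addrA; congr (_ + _); rewrite [RHS]addrC -addrA.
Qed.

Section Pair.
Context (n : nat).
Local Notation p := (P n.+1).
Local Notation q := (P n).
Local Notation g := (gam W P n).

(** Both expansions of the same integral [wI W r (P a) (P b)] are equated. *)
Lemma wronskian a b : cl (P a) *m (P b)^@ - mpeval (P a) z *m cr (P b) =
  ip (dq (P a) z) (P b) - ip (P a) (dq (P b) z^*).
Proof.
have := wI_resolventl (P a) (P b); rewrite wI_resolventr => /(canRL (addrK _)) ->.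
by rewrite addrAC [mpeval _ _ *m _ + _]addrC addrK.
Qed.

(** In the opposite order the entries of the product are Wronskians: by orthogonality they are 0 for
    equal indices and plus or minus the Gram matrix, which [g] inverts, for neighbouring ones.
    [mulmx1C] then exchanges the factors. *)
Lemma transfer_inv :
  block_mx (- (cr q *m g)) (cr p *m g) (q^@ *m g) (- (p^@ *m g)) *m
  block_mx (mpeval p z) (cl p) (mpeval q z) (cl q) = 1%:M.
Proof.
have gG : gram W P n *m g = 1%:M by rewrite gamE mulmxV // (gram_unit hW hP).
have w11 := wronskian n.+1 n; have w12 := wronskian n.+1 n.+1.
have w21 := wronskian n n; have w22 := wronskian n n.+1.
rewrite (ip_lead hW hP) ?size_dq_P // (dq_PSn hP) mul1mx (orthr hP) ?subr0 in w11; last first.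
  by rewrite leqW // size_dq_P.
rewrite (orthl hW hP) ?size_dq_P // (orthr hP) ?size_dq_P // subrr in w12.
rewrite (orthl hW hP) ?size_dq_P // (orthr hP) ?size_dq_P // subrr in w21.
rewrite (orthl hW hP) ?leqW ?size_dq_P // -(ip_adj hW) (ip_lead hW hP) ?size_dq_P // in w22.
rewrite (dq_PSn hP) mul1mx (gram_adj hW) sub0r in w22.
apply: mulmx1C; rewrite mulmx_block scalar_mx_block.
have e (X1 X2 X3 X4 : 'M[C]_N.+1) : X1 *m - (X2 *m g) + X3 *m (X4 *m g) = (X3 *m X4 - X1 *m X2) *m g.
  by rewrite mulmxN !mulmxA addrC mulmxBl.
have e' (X1 X2 X3 X4 : 'M[C]_N.+1) :
    X1 *m (X2 *m g) + X3 *m - (X4 *m g) = - ((X3 *m X4 - X1 *m X2) *m g).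
  by rewrite mulmxN !mulmxA mulmxBl opprB.
by rewrite !e !e' w11 w12 w21 w22 !mul0mx oppr0 mulNmx opprK gG.
Qed.

Lemma transfer_invE :
  [/\ cr q *m g *m mpeval p z - cr p *m g *m mpeval q z = - 1%:M,
      cr q *m g *m cl p = cr p *m g *m cl q,
      q^@ *m g *m mpeval p z = p^@ *m g *m mpeval q z &
      q^@ *m g *m cl p - p^@ *m g *m cl q = 1%:M].
Proof.
have := transfer_inv; rewrite mulmx_block scalar_mx_block !mulNmx.
move/eq_block_mx => [l1 l2 l3 l4]; split=> //.
- by rewrite -l1 opprD opprK addrC.
- by apply/eqP; rewrite eq_sym -subr_eq0 addrC l2.
- by apply/eqP; rewrite -subr_eq0 l3.
Qed.

(** Collects the combination of two values of [EmxE], both of the shape [U X - V Z], into the forms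
    that [transfer_invE] evaluates. *)
Lemma mulmx_combine (U V X1 X2 Z1 Z2 g1 M1 M2 : 'M[C]_N.+1) :
  (U *m X1 - V *m Z1) *m g1 *m M1 - (U *m X2 - V *m Z2) *m g1 *m M2 =
  U *m (X1 *m g1 *m M1 - X2 *m g1 *m M2) - V *m (Z1 *m g1 *m M1 - Z2 *m g1 *m M2).
Proof. by rewrite !mulmxBl !mulmxBr !mulmxA !opprD !opprK addrACA. Qed.

(** Weighting [E(P_a, q)] and [E(P_a, p)] with the polynomial column removes the Cauchy part [U] of
    [EmxE] and isolates [V]. *)
Lemma ladder_poly a : (n <= a <= n.+1)%N ->
  eps *: mpeval (P a)^`() z + mpeval (P a) z *m mpeval K z =
  Emx W K z (P a) q *m g *m mpeval p z - Emx W K z (P a) p *m g *m mpeval q z.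
Proof.
move=> /andP[na an]; rewrite !EmxE; try lia.
have [l1 _ l3 _] := transfer_invE.
set U := eps *: _ - _; set V := eps *: _ + _.
by rewrite mulmx_combine l1 l3 subrr mulmx0 sub0r mulmxN mulmx1 opprK.
Qed.

(** Dually, weighting with the Cauchy column removes [V] and isolates [U]. *)
Lemma ladder_cauchy a : (n <= a <= n.+1)%N ->
  eps *: c2 (P a) - cl (P a) *m K^@ =
  Emx W K z (P a) q *m g *m cl p - Emx W K z (P a) p *m g *m cl q.
Proof.
move=> /andP[na an]; rewrite !EmxE; try lia.
have [_ l2 _ l4] := transfer_invE.
set U := eps *: _ - _; set V := eps *: _ + _.
by rewrite mulmx_combine l2 l4 subrr mulmx0 mulmx1 subr0.
Qed.

End Pair.
End Ladder.

(** * The differential equation *)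

Section DifferentialEquation.
Context (R : realType) (N : nat).
Local Notation C := R[i].
Local Notation mpoly := {poly 'M[C]_N.+1}.
Context (W : R -> 'M[R]_N.+1) (hW : weight W).
Context (P : nat -> mpoly) (hP : monic_orthogonal W P).
Implicit Types (K : mpoly) (z : C).

Local Notation tau := (two_pi_i R).

Lemma two_pi_i_neq0 : tau != 0.
Proof.
rewrite /two_pi_i !mulf_neq0 ?pnatr_eq0 // eq_complex /=.
  by rewrite (gt_eqF (pi_gt0 R)).
by rewrite oner_eq0 andbF.
Qed.

Lemma P0 : P 0%N = 1.
Proof. by rewrite [P 0%N]size1_polyC ?(size_P hP) // (coef_Pn hP). Qed.

Lemma PW0 : PW W P 0 = Wc W.
Proof. by apply/funext => t; rewrite /PW P0 mpevalC mul1mx. Qed.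

Lemma cauchyE n z : Defs.cauchy (PW W P n) z = tau^-1 *: wI W (fun t => (t%:C - z)^-1) (P n) 1.
Proof.
rewrite /Defs.cauchy wIE; apply: (congr1 (fun M => tau^-1 *: M)).
apply: eq_mxintegral => t; by rewrite /PW mpevalC trmx1 map_mx1 mulmx1.
Qed.

Definition dcauchy n z : 'M[C]_N.+1 :=
  tau^-1 *: wI W (fun t => (t%:C - z)^-1 ^+ 2) (P n) 1.

Lemma cauchy_derive n z : complex.Im z != 0 ->
  is_cderive (Defs.cauchy (PW W P n)) z (dcauchy n z).
Proof.
move=> z0 i j.
have hi : cintegrable (fun t => PW W P n t i j).
  have := @wI_integrable _ _ W _ (P n) 1 (weight_moments hW) (@tame1 R) i j.
  by apply: eq_cintegrable => t; rewrite scale1r mpevalC trmx1 map_mx1 mulmx1.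
apply: cder_ext (cderM (cder_cst tau^-1 z) (cder_cauchy hi z0)) => [w|].
  rewrite /Defs.cauchy /mxintegral !mxE; congr (_ * cintegral _).
  by apply/funext => t; rewrite [RHS]mxE.
rewrite mul0r add0r /dcauchy wIE /mxintegral !mxE; congr (_ * cintegral _).
by apply/funext => t; rewrite [RHS]mxE mpevalC trmx1 map_mx1 mulmx1.
Qed.

Definition dY n z : 'M[C]_(N.+1 + N.+1) :=
  if n is p.+1 then
    block_mx (mpeval (P n)^`() z) (dcauchy n z)
      (- tau *: (gam W P p *m mpeval (P p)^`() z)) (- tau *: (gam W P p *m dcauchy p z))
  else block_mx 0 (dcauchy 0 z) 0 0.

Lemma Y_derive n z : complex.Im z != 0 -> is_cderive (Y W P n) z (dY n z).
Proof.
move=> z0; case: n => [|n].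
  rewrite /Y /dY -PW0.
  by apply: is_cderive_block; [exact: is_cderive_cst|exact: cauchy_derive|exact: is_cderive_cst..].
have gZ F L : is_cderive F z L ->
    is_cderive (fun w => - tau *: (gam W P n *m F w)) z (- tau *: (gam W P n *m L)).
  move=> FL; apply: is_cderive_ext
    (is_cderiveZ (cder_cst (- tau) z) (is_cderiveM (is_cderive_cst (gam W P n) z) FL)) => //.
  by rewrite scale0r mul0mx !add0r.
apply: is_cderive_block; [exact: mpeval_derive|exact: cauchy_derive|apply: gZ..].
  exact: mpeval_derive.
exact: cauchy_derive.
Qed.

(** For index [n + 1] the first row of [Y] follows from the ladder relations with [a = n + 1], and
    the second, up to the factor [- tau g], from those with [a = n]. Index 0 is handled directly. *)
Lemma Y_ladder K (eps : C) n z : complex.Im z != 0 ->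
  (forall t : R, eps *: Wc (dweight W) t =
     mpeval K t%:C *m Wc W t + Wc W t *m (mpeval K t%:C)^t*) ->
  eps *: dY n z = Fmx W P K n z *m Y W P n z -
    Y W P n z *m block_mx (mpeval K z) 0 0 (- adjf (mpeval K) z).
Proof.
move=> z0 hK; have t0 := two_pi_i_neq0.
have gG k : gram W P k *m gam W P k = 1%:M by rewrite gamE mulmxV // (gram_unit hW hP).
have calAE' k : - tau^-1 *: (invmx (gam W P k) *m calA W P K k z) =
    tau^-1 *: Emx W K z (P k) (P k).
  rewrite (calAE hW hP) gamE invmxK -gamE mulNmx mulmxN mulmxA gG mul1mx scaleNr scalerN opprK.
  by [].
case: n => [|n].
  rewrite /dY /Y /Fmx /= -PW0 cauchyE /dcauchy calAE'.
  rewrite !mulmx_block !(mulmx0, mul0mx, mulmx1, mul1mx, addr0, add0r, opprK).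
  rewrite scale_block_mx opp_block_mx add_block_mx !scaler0.
  have -> : adjf (fun z => - mpeval K z) z = - adjf (mpeval K) z by exact: trmxCN.
  rewrite !subrr mulmxN opprK.
  (* At index 0 only the upper right entry has content; it is [EmxE] for [P 0 = 1]. *)
  have := EmxE hW hP hK z0 (leqnSn 0) (leqnSn 0).
  rewrite P0 derivC mpeval0 mpevalC !mul1mx scaler0 add0r.
  have -> : adjf (mpeval 1) z = 1%:M :> 'M[C]_N.+1 by rewrite /adjf mpevalC trmx1 map_mx1.
  rewrite mulmx1 => ->; congr block_mx.
  rewrite scalerA mulrC -scalerA -scalemxAr -scalemxAl -!scalerDr; congr (_ *: _).
  by rewrite [X in _ = X + _]addrC !subrK.
have lp := ladder_poly hW hP hK z0 (n := n).
have lc := ladder_cauchy hW hP hK z0 (n := n).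
rewrite /dY /Y /Fmx calAE' (calBE hW hP) !cauchyE /dcauchy.
have -> : adjf (calB W P K n.+1) z = - (gam W P n *m Emx W K z (P n) (P n.+1)).
  by rewrite /adjf (calBE hW hP) trmxCM trmxCN (gam_adj hW) (Emx_adj hW) mulmxN.
rewrite (calAE hW hP) !mulmx_block scale_block_mx opp_block_mx add_block_mx.
rewrite !(mulmx0, mul0mx, addr0, add0r).
set g := gam W P n.
have sA (E X : 'M[C]_N.+1) : tau^-1 *: E *m (- tau *: (g *m X)) = - (E *m g *m X).
  by rewrite -scalemxAl -scalemxAr scalerA mulrN mulVf // scaleN1r mulmxA.
have dp k : (n <= k <= n.+1)%N -> eps *: mpeval (P k)^`() z =
    Emx W K z (P k) (P n) *m g *m mpeval (P n.+1) z -
    Emx W K z (P k) (P n.+1) *m g *m mpeval (P n) z - mpeval (P k) z *m mpeval K z.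
  by move=> /lp <-; rewrite addrK.
have dc k : (n <= k <= n.+1)%N -> eps *: wI W (fun t => (t%:C - z)^-1 ^+ 2) (P k) 1 =
    Emx W K z (P k) (P n) *m g *m wI W (fun t => (t%:C - z)^-1) (P n.+1) 1 -
    Emx W K z (P k) (P n.+1) *m g *m wI W (fun t => (t%:C - z)^-1) (P n) 1 +
    wI W (fun t => (t%:C - z)^-1) (P k) 1 *m adjf (mpeval K) z.
  by move=> /lc <-; rewrite subrK.
have epsZ a (M : 'M[C]_N.+1) : eps *: (a *: M) = a *: (eps *: M).
  by rewrite !scalerA mulrC.
congr block_mx.
- by rewrite dp ?leqnSn ?leqnn // sA !mulNmx opprK.
- rewrite epsZ dc ?leqnSn ?leqnn // sA !mulNmx opprK mulmxN opprK.
  by rewrite -!scalemxAr -scalemxAl scalerDr scalerBr.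
- rewrite epsZ scalemxAr dp ?leqnSn ?leqnn // !mulmxBr !scalerBr.
  rewrite !mulNmx -!scalemxAr -!scalemxAl !mulmxA !scaleNr.
  by rewrite mulNmx scalerN.
- rewrite epsZ -scalemxAr epsZ [eps *: (g *m _)]scalemxAr dc ?leqnSn ?leqnn //.
  move: (Emx W K z (P n) (P n)) (Emx W K z (P n) (P n.+1)) (adjf (mpeval K) z) => E1 E2 Ka.
  rewrite !mulmxDr !scalerDr -!scalemxAr -!scalemxAl.
  have tC (M : 'M[C]_N.+1) : tau^-1 *: (tau *: M) = tau *: (tau^-1 *: M).
    by rewrite !scalerA mulrC.
  by rewrite !(mulmxN, mulNmx, scalerN, scaleNr, opprK, mulmxA) tC.
Qed.

End DifferentialEquation.

(** * The weight and its derivative *)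

Section Pearson.
Context (R : realType) (N : nat).
Local Notation C := R[i].
Context (W : R -> 'M[R]_N.+1) (hW : weight W).

Lemma Wc_unit t : Wc W t \in unitmx.
Proof.
rewrite /Wc map_unitmx unitmxE unitfE; apply/det0P => -[v v0 vW].
have [_ /(_ t)[_ /(_ v v0) vp] _] := hW.
by move: vp; rewrite vW mul0mx mxE ltxx.
Qed.

(** Differentiating an extension of [W] along the real line recovers the derivative of the weight;
    for [T T#] this yields the equation assumed in [Y_ladder]. *)
Lemma dweight_cderive (U U' : C -> 'M[C]_N.+1) :
  (forall z, is_cderive U z (U' z)) -> (forall t : R, U t%:C = Wc W t) ->
  forall t : R, U' t%:C = Wc (dweight W) t.
Proof.
move=> dU UW t; apply/matrixP => i j.
have [d1 d2] := is_derive_real (dU t%:C i j).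
have e1 : (fun s : R => complex.Re (U s%:C i j)) = (fun s => W s i j).
  by apply/funext => s; rewrite UW mxE.
have e2 : (fun s : R => complex.Im (U s%:C i j)) = cst 0.
  by apply/funext => s; rewrite UW mxE.
rewrite e1 in d1; rewrite e2 in d2.
rewrite [RHS]mxE; apply/eqP; rewrite eq_complex /=; apply/andP; split; apply/eqP.
  have [_ <-] := d1; have [_ <-] := is_derive_weight hW i j t.
  by [].
have [_ <-] := d2; exact: derive_cst.
Qed.

End Pearson.

(** * The factorization and the two equations for [X] *)

Theorem proposition3p3 (R : realType) (N : nat)
  (W : R -> 'M[R]_N.+1) (hW : weight W)
  (T : R[i] -> 'M[R[i]]_N.+1) (G : {poly 'M[R[i]]_N.+1})
  (hWT : forall x : R, Wc W x = T x%:C *m adjf T x%:C)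
  (hT : forall z : R[i], is_cderive T z (mpeval G z *m T z))
  (P : nat -> {poly 'M[R[i]]_N.+1}) (hP : monic_orthogonal W P)
  (S : R[i] -> 'M[R[i]]_N.+1)
  (hS : entire S)
  (hSnonconst : exists z w : R[i], S z <> S w)
  (hSunit : forall z : R[i], S z \in unitmx)
  (hSunitary : forall x : R, S x%:C \is unitarymx)
  (H : {poly 'M[R[i]]_N.+1})
  (hH : forall z : R[i],
     mpeval H z = T z *m cderiv S z *m adjf S z *m invmx (T z)) :
  let TS := fun z : R[i] => T z *m S z in
  let chi := fun z : R[i] => cderiv S z *m adjf S z in
  [/\ forall x : R, Wc W x = TS x%:C *m adjf TS x%:C,
      forall z : R[i], is_cderive TS z (mpeval (G + H) z *m TS z) &
      forall (n : nat) (z : R[i]), complex.Im z != 0 ->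
        is_cderive (X W P T n) z (Fmx W P G n z *m X W P T n z) /\
        is_cderive (X W P T n) z
          ((Fmx W P G n z + Fmx W P H n z) *m X W P T n z
           - X W P T n z *m block_mx (chi z) 0 0 (- adjf chi z))].
Proof.
have uT z : T z \in unitmx.
  (* At 0 the factor [T] is invertible because [W(0)] is positive definite; the equation carries
     this to every point. *)
  apply: (@ode_unitmx R N G T 0 z hT).
  by have := Wc_unit hW 0; rewrite hWT unitmx_mul => /andP[].
have uT' z : adjf T z \in unitmx by rewrite /adjf map_unitmx unitmx_tr.
have [dS skew SS1] := unitary_extension hT uT hS hSunitary hH.
move=> TS chi.
have HT z : mpeval H z *m T z = T z *m chi z.
  by rewrite hH mulmxKV // /chi !mulmxA.
have adjR A (t : R) : adjf (mpeval (A : {poly 'M[R[i]]_N.+1})) t%:C = (mpeval A t%:C)^t*.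
  by rewrite /adjf conjc_real.
have dadjT z : is_cderive (adjf T) z (adjf T z *m adjf (mpeval G) z).
  by rewrite -adjfM; exact/is_cderive_adjf.
have pearsonG (t : R) : 1 *: Wc (dweight W) t =
    mpeval G t%:C *m Wc W t + Wc W t *m (mpeval G t%:C)^t*.
  rewrite scale1r -(dweight_cderive hW (U := fun z => T z *m adjf T z)
    (fun z => is_cderiveM (hT z) (dadjT z)) (fun t => esym (hWT t))).
  by rewrite hWT adjR !mulmxA.
(* The case [eps = 0] is the skew relation of [unitary_extension], restricted to the line. *)
have pearsonH (t : R) : 0 *: Wc (dweight W) t =
    mpeval H t%:C *m Wc W t + Wc W t *m (mpeval H t%:C)^t*.
  by rewrite scale0r hWT -adjR skew.
split=> [x|z|n z z0].
- rewrite /TS adjfM mulmxA -[T _ *m _ *m _]mulmxA.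
  have -> : S x%:C *m adjf S x%:C = 1%:M by exact: mulmx1C.
  by rewrite mulmx1.
- apply: is_cderive_ext (is_cderiveM (hT z) (dS z)) => //.
  rewrite mpevalD mulmxDl /TS !mulmxA; congr (_ + _).
  by rewrite HT /chi -!mulmxA SS1 mulmx1.
have dV : is_cderive (V T) z (block_mx (mpeval G z) 0 0 (- adjf (mpeval G) z) *m V T z).
  have := is_cderive_block (hT z) (is_cderive_cst 0 z) (is_cderive_cst 0 z)
    (is_cderive_inv uT' (dadjT z)).
  apply: is_cderive_ext => // ; rewrite /V mulmx_block !(mulmx0, mul0mx, addr0, add0r).
  by rewrite mulKmx // mulNmx.
have dX : is_cderive (X W P T n) z (Fmx W P G n z *m X W P T n z).
  apply: is_cderive_ext (is_cderiveM (Y_derive hW hP n z0) dV) => //.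
  have := Y_ladder hW hP n z0 pearsonG; rewrite scale1r => ->.
  by rewrite /X mulmxBl !mulmxA subrK.
(* The second form of the derivative amounts to [F_n(H) X = X diag(chi, - chi#)]: [FH] moves
   [F_n(H)] past [Y], and [HV] moves the result past [V]. *)
split=> //; apply: is_cderive_ext dX => //.
have /eqP := Y_ladder hW hP n z0 pearsonH; rewrite scale0r eq_sym subr_eq0 => /eqP FH.
have HV : block_mx (mpeval H z) 0 0 (- adjf (mpeval H) z) *m V T z =
    V T z *m block_mx (chi z) 0 0 (- adjf chi z).
  rewrite /V !mulmx_block !(mulmx0, mul0mx, addr0, add0r) HT; congr block_mx.
  (* The lower block uses the adjoint of [H T = T chi]. *)
  have e : adjf T z *m adjf (mpeval H) z = adjf chi z *m adjf T z.
    by rewrite -!adjfM; congr (_^t*); exact: HT.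
  apply: (can_inj (mulKmx (uT' z))); rewrite mulNmx !mulmxN mulmxA e mulmxA mulmxV //.
  by rewrite mul1mx mulmxK.
move: FH HV; rewrite /X mulmxDl.
move: (Fmx W P G n z) (Fmx W P H n z) (Y W P n z) (V T z) (block_mx (mpeval H z) _ _ _)
  (block_mx (chi z) _ _ _) => FG FH Yn Vn B1 B2 eF eV.
by rewrite (mulmxA FH) eF -(mulmxA Yn) eV (mulmxA Yn) addrK.
Qed.
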